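(* Let $\Omega\subset\mathbb{R}^d$, $d\in\{2,3\}$, be a Lipschitz polytopal domain whose boundary is partitioned into three non-overlapping polytopal Lipschitz subsets $\Gamma_{\mathrm D},\Gamma_{\mathrm N},\Gamma_{\mathrm R}$ (some possibly empty), let $\mathcal{T}_h$ be a conforming simplicial mesh of $\Omega$ such that each boundary face lies in exactly one of these subsets, let $p\ge0$ be an integer and let $\kappa>0$. Let $\Pi:G_h\to G_h$ be the global exchange operator and $\mathsf{S}:G_h\to G_h$ the global scattering operator (both defined in the context). Then $\Pi\mathsf{S}$ is a strict contraction in the sense that $$\|\Pi\mathsf{S}(g^{\ominus}_h)\|<\|g^{\ominus}_h\|\qquad\text{for all } g^{\ominus}_h\in G_h\setminus\{0\}.$$
   Context: $\imath$ is the imaginary unit. $\mathcal{P}_p(\cdot)$ and $\boldsymbol{\mathcal{P}}_p(\cdot)$ denote the spaces of complex scalar-valued polynomials and of complex $\mathbb{C}^d$-valued polynomials (each component) of degree at most $p$ on the indicated set. For an element $K\in\mathcal{T}_h$, $\mathcal{F}_K$ is its set of faces and $\mathbf{n}_{K,F}$ is the unit outward normal to $K$ on $F\in\mathcal{F}_K$. The mesh being conforming, each face not contained in $\partial\Omega$ (interior face) is shared by exactly two elements. For a boundary face $F\subset\partial\Omega$, ''$F\subset\Gamma_{\mathrm D}$'' (resp. $\Gamma_{\mathrm N}$, $\Gamma_{\mathrm R}$) means that $F$ lies in the (closure of the) corresponding part of the boundary. The sesquilinear forms are $(u,v)_K:=\int_K u\,\overline{v}\,d\mathbf{x}$, $(\mathbf{u},\mathbf{v})_K:=\int_K\mathbf{u}\cdot\overline{\mathbf{v}}\,d\mathbf{x}$,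 $\langle u,v\rangle_F:=\int_F u\,\overline{v}\,d\sigma(\mathbf{x})$, and $\|\cdot\|_F$ is the $L^2(F)$ norm. The space $G_h:=\prod_{K\in\mathcal{T}_h}\prod_{F\in\mathcal{F}_K}\mathcal{P}_p(F)$ (two components per interior face, one per boundary face) is equipped with the norm $\|g^{\ominus}_h\|:=\big(\sum_{K\in\mathcal{T}_h}\sum_{F\in\mathcal{F}_K}\|g^{\ominus}_{K,F}\|_F^2\big)^{1/2}$. Global exchange operator: for $g\in G_h$, $K\in\mathcal{T}_h$ and $F\in\mathcal{F}_K$, $$\Pi(g)|_{K,F}=\begin{cases} g_{K',F} & \text{if } F\not\subset\partial\Omega \text{ is shared by } K \text{ and } K',\\ -g_{K,F} & \text{if } F\subset\Gamma_{\mathrm D},\\ g_{K,F} & \text{if } F\subset\Gamma_{\mathrm N},\\ 0 & \text{if } F\subset\Gamma_{\mathrm R}.\end{cases}$$ Local problem on $K$: given $g^{\ominus}_{K,F}\in\mathcal{P}_p(F)$ for all $F\in\mathcal{F}_K$, find $(u_K,\mathbf{q}_K)\in\mathcal{P}_p(K)\times\boldsymbol{\mathcal{P}}_p(K)$ such that, for all $(v_K,\mathbf{p}_K)\in\mathcal{P}_p(K)\times\boldsymbol{\mathcal{P}}_p(K)$, $$-\imath\kappa (u_K,v_K)_K-(\mathbf{q}_K,\nabla v_K)_K+\sum_{F\in\mathcal{F}_K}\big\langle \tfrac12 g^{\oplus}_{K,F},v_K\big\rangle_F=\sum_{F\in\mathcal{F}_K}\big\langle \tfrac12 g^{\ominus}_{K,F},v_K\big\rangle_F,$$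 $$-\imath\kappa (\mathbf{q}_K,\mathbf{p}_K)_K-(u_K,\nabla\cdot\mathbf{p}_K)_K+\sum_{F\in\mathcal{F}_K}\big\langle \tfrac12 g^{\oplus}_{K,F},\mathbf{n}_{K,F}\cdot\mathbf{p}_K\big\rangle_F=-\sum_{F\in\mathcal{F}_K}\big\langle \tfrac12 g^{\ominus}_{K,F},\mathbf{n}_{K,F}\cdot\mathbf{p}_K\big\rangle_F,$$ where $g^{\oplus}_{K,F}:=u_K+\mathbf{n}_{K,F}\cdot\mathbf{q}_K$ on each $F$. This problem has exactly one solution for every data. Global scattering operator: for $g^{\ominus}_h\in G_h$, $K\in\mathcal{T}_h$ and $F\in\mathcal{F}_K$, $\mathsf{S}(g^{\ominus}_h)|_{K,F}:=(u_K+\mathbf{n}_{K,F}\cdot\mathbf{q}_K)|_F$, where $(u_K,\mathbf{q}_K)$ is the solution of the local problem on $K$ with data $(g^{\ominus}_{K,F})_{F\in\mathcal{F}_K}$ taken from $g^{\ominus}_h$. *)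

(* Defs.v *)
From HB Require Import structures.
From mathcomp Require Import all_boot all_order all_algebra.
(* the notations of mpoly clash with those of analysis *)
From mathcomp Require Import -(notations) mpoly.
From mathcomp Require Import all_classical all_reals all_analysis.
From mathcomp Require Import complex.

Set Implicit Arguments.
Unset Strict Implicit.
Unset Printing Implicit Defensive.

Import Order.TTheory GRing.Theory Num.Theory.
Import numFieldNormedType.Exports.

Local Open Scope classical_set_scope.
Local Open Scope ring_scope.
Local Open Scope complex_scope.

(* Lebesgue measure on R^n, built coordinate by coordinate as a product of
   one-dimensional Lebesgue measures; R^n carries here the product
   sigma-algebra of [n.-tuple]. *)
Section tuple_product.
Context (R : realType) (d : measure_display) (T : measurableType d) (n : nat).
Variables (mu : {sigma_finite_measure set T -> \bar R})
  (m : {sigma_finite_measure set (n.-tuple T) -> \bar R}).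

Definition tcons (xt : T * n.-tuple T) : n.+1.-tuple T :=
  [the n.+1.-tuple T of xt.1 :: xt.2].

Lemma measurable_tcons : measurable_fun [set: T * n.-tuple T] tcons.
Proof.
by apply: measurable_cons; [exact: measurable_fst | exact: measurable_snd].
Qed.

Definition tuple_product :=
  pushforward (mu \x m)%E tcons.

Let step0 : tuple_product set0 = 0%E.
Proof. by rewrite /tuple_product /pushforward preimage_set0 measure0. Qed.

Let step_ge0 A : (0 <= tuple_product A)%E.
Proof. by rewrite /tuple_product /pushforward; exact: measure_ge0. Qed.

Let step_sigma : semi_sigma_additive tuple_product.
Proof.
move=> F mF tF mUF; rewrite /tuple_product /pushforward preimage_bigcup.
apply: measure_semi_sigma_additive.
- by move=> i; rewrite -[X in measurable X]setTI; exact: measurable_tcons.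
- apply/trivIsetP => /= i j _ _ ij; rewrite -preimage_setI.
  by move/trivIsetP : tF => /(_ _ _ _ _ ij) ->//; rewrite preimage_set0.
- by rewrite -preimage_bigcup -[X in measurable X]setTI;
    exact: measurable_tcons.
Qed.

HB.instance Definition _ :=
  isMeasure.Build _ _ _ tuple_product step0 step_ge0 step_sigma.

Let step_sfinite : sigma_finite setT tuple_product.
Proof.
have /sigma_finiteP[F [FT ndF Foo]] := sigma_finiteT mu.
have /sigma_finiteP[G [GT ndG Goo]] := sigma_finiteT m.
pose h (t : n.+1.-tuple T) : T * n.-tuple T :=
  (tnth t ord0, [tuple of behead t]).
have mh : measurable_fun [set: n.+1.-tuple T] h.
  apply/measurable_fun_pair => /=; first exact: measurable_tnth.
  exact: measurable_behead.
have hK : cancel tcons h.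
  by move=> [x t]; congr pair; apply: val_inj.
exists (fun i => h @^-1` (F i `*` G i)).
  rewrite -preimage_bigcup (_ : \bigcup_i _ = setT) ?preimage_setT//.
  apply/seteqP; split=> // -[x y] _.
  have [i _ Fx] : (\bigcup_i F i) x by rewrite -FT.
  have [j _ Gy] : (\bigcup_i G i) y by rewrite -GT.
  exists (maxn i j) => //; split => /=.
  - by move: x Fx; exact/subsetPset/ndF/leq_maxl.
  - by move: y Gy; exact/subsetPset/ndG/leq_maxr.
move=> i; have [mF Fi] := Foo i; have [mG Gi] := Goo i; split.
  rewrite -[X in measurable X]setTI; apply: mh => //; exact: measurableX.
rewrite /tuple_product /pushforward -comp_preimage.
rewrite (_ : h \o tcons = id); last by apply/funext => x; exact: hK.
by rewrite preimage_id product_measure1E// lte_mul_pinfty// ge0_fin_numE.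
Qed.

HB.instance Definition _ :=
  Measure_isSigmaFinite.Build _ _ _ tuple_product step_sfinite.

End tuple_product.

Fixpoint lebesgueRn (R : realType) (n : nat) :
    {sigma_finite_measure set (n.-tuple (measurableTypeR R)) -> \bar R} :=
  match n with
  | 0 => [the {sigma_finite_measure set _ -> \bar R} of
            dirac [tuple of [::]]]
  | n'.+1 => [the {sigma_finite_measure set _ -> \bar R} of
            tuple_product (@lebesgue_measure R) (lebesgueRn R n')]
  end.

Section geometry.
Context (R : realType) (d : nat).
Local Notation point := 'rV[R]_d.

Definition dot (x y : point) : R := \sum_i x 0 i * y 0 i.

Definition hull (I : finType) (a : I -> point) (B : {set I}) : set point :=
  [set x | exists w : I -> R,
     [/\ forall i, i \in B -> 0 <= w i,
         \sum_(i in B) w i = 1 &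
         x = \sum_(i in B) w i *: a i]].

Definition aff_independent (I : finType) (a : I -> point) (B : {set I}) :=
  forall c : I -> R, \sum_(i in B) c i = 0 -> \sum_(i in B) c i *: a i = 0 ->
  forall i, i \in B -> c i = 0.

(* up to closure, A is a finite (possibly empty) union of nondegenerate
   k-simplices *)
Definition polytopal (k : nat) (A : set point) :=
  exists (m : nat) (a : 'I_m -> 'I_k.+1 -> point),
    (forall j, aff_independent (a j) [set: 'I_k.+1]%SET) /\
    closure A = \bigcup_j hull (a j) [set: 'I_k.+1]%SET.

Definition boundary (A : set point) : set point := closure A `\` A°.

(* Near x, A lies strictly above the graph of the Lipschitz function phi in the
   direction of the unit vector e. Only the values of phi on the hyperplane
   orthogonal to e matter. *)
Definition lipschitz_chart (A : set point) (x e : point) (phi : point -> R^o) :=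
  [/\ dot e e = 1, lipschitz phi &
      \forall y \near x, A y <-> phi (y - dot y e *: e) < dot y e].

Definition lipschitz_boundary (A : set point) :=
  forall x, boundary A x -> exists e phi, lipschitz_chart A x e phi.

(* boundedness follows from [polytopal d Omega] *)
Definition lipschitz_polytopal_domain (Omega : set point) :=
  [/\ open Omega, connected Omega, Omega !=set0, polytopal d Omega &
      lipschitz_boundary Omega].

(* Near each point x of its relative boundary, the relatively open part G of
   the boundary of Omega is, seen in a chart of Omega, one side of a Lipschitz
   graph in the hyperplane orthogonal to e. *)
Definition lipschitz_part (Omega G : set point) :=
  forall x, (closure G `\` G) x ->
  exists (e : point) (phi : point -> R^o) (t : point) (psi : point -> R^o),
    [/\ lipschitz_chart Omega x e phi, dot t t = 1, dot t e = 0,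
        lipschitz psi &
        \forall y \near x, boundary Omega y ->
          (G y <-> psi (y - dot y e *: e - dot y t *: t) < dot y t)].

Inductive bc := Dirichlet | Neumann | Robin.

Definition boundary_partition (Omega : set point) (Gamma : bc -> set point) :=
  [/\ forall b, exists2 U, open U & Gamma b = U `&` boundary Omega,
      forall b b', b <> b' -> Gamma b `&` Gamma b' = set0,
      boundary Omega = \bigcup_b closure (Gamma b),
      forall b, polytopal d.-1 (Gamma b) &
      forall b, lipschitz_part Omega (Gamma b)].

End geometry.

Section integration.
Context (R : realType).
Local Notation C := (R[i]).

Definition row_of_tuple n (t : n.-tuple (measurableTypeR R)) : 'rV[R]_n :=
  \row_i tnth t i.

Definition Cintegral n (D : set 'rV[R]_n) (f : 'rV[R]_n -> C) : C :=
  (\int[lebesgueRn R n]_(t in @row_of_tuple n @^-1` D)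
     complex.Re (f (row_of_tuple t))) +i*
  (\int[lebesgueRn R n]_(t in @row_of_tuple n @^-1` D)
     complex.Im (f (row_of_tuple t))).

Definition unit_simplex n : set 'rV[R]_n :=
  [set t | (forall i, 0 <= t 0 i) /\ \sum_i t 0 i <= 1].

End integration.

Section discretization.
Context (R : realType) (d : nat) (V : finType) (vtx : V -> 'rV[R]_d).
Local Notation C := (R[i]).
Local Notation point := 'rV[R]_d.
Local Notation poly := (mpoly d C).

Implicit Types (K F : {set V}) (T : {set {set V}}) (p : nat) (kappa : R).

(* A mesh element K is given by its set of vertices, and so are its faces; the
   corresponding subset of R^d is [hull vtx K]. *)
Definition faces K : {set {set V}} := [set K :\ v | v in K]%SET.

Definition conforming_mesh T (Omega : set point) :=
  [/\ forall K, K \in T -> #|K| = d.+1 /\ aff_independent vtx K,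
      closure Omega = \bigcup_(K in [set K | K \in T]) hull vtx K &
      forall K K', K \in T -> K' \in T ->
        hull vtx K `&` hull vtx K' = hull vtx (K :&: K')%SET].

Definition boundary_face (Omega : set point) F :=
  hull vtx F `<=` boundary Omega.

Definition boundary_fitted T (Omega : set point) (Gamma : bc -> set point) :=
  forall K F, K \in T -> F \in faces K -> boundary_face Omega F ->
  exists! b, hull vtx F `<=` closure (Gamma b).

Definition outward_unit_normal K F (n : point) :=
  [/\ dot n n = 1,
      forall v w, v \in F -> w \in F -> dot n (vtx w - vtx v) = 0 &
      forall v w, v \in F -> w \in K -> w \notin F ->
        dot n (vtx w - vtx v) < 0].

Definition unit_normal K F : point := xget 0 (outward_unit_normal K F).

(* The face F, with vertices a_0, ..., a_(d-1), is parametrized by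
   t |-> a_0 + sum_i t_i (a_(i+1) - a_0) on the unit simplex of R^(d-1), and its
   surface element is the square root of the Gram determinant. *)
Definition face_seq F : seq point := [seq vtx v | v <- enum F].
Definition face_mx F : 'M[R]_(d.-1, d) :=
  \matrix_(i, j) ((face_seq F)`_i.+1 - (face_seq F)`_0) 0 j.
Definition face_param F (t : 'rV[R]_d.-1) : point :=
  (face_seq F)`_0 + t *m face_mx F.

Definition face_integral F (f : point -> C) : C :=
  (Num.sqrt (\det (face_mx F *m (face_mx F)^T)))%:C *
  Cintegral (@unit_simplex R d.-1) (f \o face_param F).

Definition ipK K (u v : point -> C) : C :=
  Cintegral (hull vtx K) (fun x => u x * conjc (v x)).
Definition ipF F (u v : point -> C) : C :=
  face_integral F (fun x => u x * conjc (v x)).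
Definition normF F (u : point -> C) : R := Num.sqrt (complex.Re (ipF F u u)).

(* [mmeasure mdeg] is one more than the total degree *)
Definition deg_le p (P : poly) := (mmeasure mdeg P <= p.+1)%N.
Definition peval (P : poly) (x : point) : C :=
  meval (fun i => (x 0 i)%:C) P.

(* functions on a subset A are represented by their extension by 0 *)
Definition ext0 (A : set point) (f : point -> C) : point -> C :=
  fun x => if x \in A then f x else 0.

Definition PF p F : set (point -> C) :=
  [set ext0 (hull vtx F) (peval P) | P in [set P : poly | deg_le p P]].

(* element-face families; the components whose indices are not a face of an
   element of the mesh are 0 *)
Definition skeleton_family := {set V} -> {set V} -> point -> C.

Definition G_h T p : set skeleton_family :=
  [set g | forall K F,
     if (K \in T) && (F \in faces K) then PF p F (g K F) else g K F = 0].

Definition norm_Gh T (g : skeleton_family) : R :=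
  Num.sqrt (\sum_(K in T) \sum_(F in faces K) normF F (g K F) ^+ 2).

Definition exchange T (Omega : set point) (Gamma : bc -> set point)
    (g : skeleton_family) : skeleton_family := fun K F =>
  if ~~ ((K \in T) && (F \in faces K)) then 0
  else if `[< ~ boundary_face Omega F >] then
    (if [pick K' in T | (K' != K) && (F \in faces K')] is Some K'
     then g K' F else 0)
  else if `[< hull vtx F `<=` closure (Gamma Dirichlet) >] then - g K F
  else if `[< hull vtx F `<=` closure (Gamma Neumann) >] then g K F
  else 0.

(* The unknowns on an element are formal polynomials: an element has nonempty
   interior, so that they are determined by their values on it. *)
Local Notation unknowns := (poly * {ffun 'I_d -> poly})%type.

Definition normal_trace K F (q : {ffun 'I_d -> poly}) : point -> C :=
  fun x => \sum_i (unit_normal K F 0 i)%:C * peval (q i) x.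

Definition outgoing K F (uq : unknowns) : point -> C :=
  fun x => peval uq.1 x + normal_trace K F uq.2 x.

Definition half (f : point -> C) : point -> C := fun x => 2^-1 * f x.

Definition local_problem p kappa K (g : {set V} -> point -> C)
    (uq : unknowns) :=
  let: (u, q) := uq in
  [/\ deg_le p u, forall i, deg_le p (q i),
      forall v : poly, deg_le p v ->
        - 'i%C * kappa%:C * ipK K (peval u) (peval v)
        - \sum_i ipK K (peval (q i)) (peval (mderiv i v))
        + \sum_(F in faces K) ipF F (half (outgoing K F uq)) (peval v)
        = \sum_(F in faces K) ipF F (half (g F)) (peval v) &
      forall r : {ffun 'I_d -> poly}, (forall i, deg_le p (r i)) ->
        - 'i%C * kappa%:C * \sum_i ipK K (peval (q i)) (peval (r i))
        - ipK K (peval u) (peval (\sum_i mderiv i (r i)))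
        + \sum_(F in faces K)
            ipF F (half (outgoing K F uq)) (normal_trace K F r)
        = - \sum_(F in faces K) ipF F (half (g F)) (normal_trace K F r)].

Definition local_solution p kappa K (g : {set V} -> point -> C) : unknowns :=
  xget (0, [ffun=> 0]) (local_problem p kappa K g).

Definition scattering T p kappa (g : skeleton_family) : skeleton_family :=
  fun K F =>
    if (K \in T) && (F \in faces K)
    then ext0 (hull vtx F) (outgoing K F (local_solution p kappa K (g K)))
    else 0.

End discretization.

(* Main.v *)
Require Import Defs.
From HB Require Import structures.
From mathcomp Require Import all_boot all_order all_algebra.
From mathcomp Require Import -(notations) mpoly.
From mathcomp Require Import all_classical all_reals all_analysis.
From mathcomp Require Import complex.
From mathcomp Require Import ring lra measurable_realfun.

(* On an element K, test the local problem with its own solution (u, q) and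
   write Q = n . q on the faces. Since the volume terms with kappa are purely
   imaginary, the divergence theorem turns the real part of the sum of the two
   equations into
     |u + Q|^2 = |g|^2 - |g - (u - Q)|^2,
   the norms being summed over the faces of K. Hence S does not increase the
   norm on K, and equality forces g = u - Q. In that case the face terms of the
   local problem cancel, so that c u + div q = 0 and c q + grad u = 0 on K with
   c = - i kappa; each of u and q can then be replaced by polynomials of lower
   and lower degree, thus u = 0, q = 0 and g = 0. If the local problem had no
   solution, the scattered data on K would be 0 by convention and the bound
   would hold as well, so well-posedness plays no role.
   The exchange operator does not increase the norm because a face belongs to at
   most two elements: two elements lying on the same side of a common face would
   have overlapping interiors.
   The divergence theorem for polynomials on a simplex reduces, along the edges
   of K, to Fubini and the fundamental theorem of calculus on the unit simplex,
   through the affine change of variables for the product Lebesgue measure. *)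

Set Implicit Arguments.
Unset Strict Implicit.
Unset Printing Implicit Defensive.

Import Order.TTheory GRing.Theory Num.Theory.
Import numFieldNormedType.Exports.

Local Open Scope classical_set_scope.
Local Open Scope ring_scope.
Local Open Scope complex_scope.

Local Notation Re := complex.Re.
Local Notation Im := complex.Im.

(** * Change of variables for the product Lebesgue measure *)

(** All integrals are pulled back to unit simplices through an enumeration of the vertices.
    [face_integral] fixes the order given by [enum], whereas Fubini along an edge wants the two ends
    of that edge at the head of the list; this is why integrals must be shown independent of the
    enumeration. Edges are the right directions because the normals of all faces but two are
    orthogonal to a given edge, while the edges span the space and both sides of the divergence
    theorem are linear in the direction. The factor left on those two faces is a determinant of the
    element, equal to surface element times height; the Gram determinant and the unit normal enter
    there.

    Since the coordinates are real, conjugating coefficients keeps a product [u] times conjugate [v]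
    polynomial, so every inner product is a linear functional applied to one polynomial. Polynomials
    are compared only through their values on [K], a relation that differentiation respects, again
    by the divergence theorem. *)

Section pushforward_measure.
Context d1 d2 (T1 : measurableType d1) (T2 : measurableType d2) (R : realType).
Variables (m : {measure set T1 -> \bar R}) (f : T1 -> T2).
Hypothesis mf : measurable_fun setT f.

(** Bundled with its measure structure, so that it can be rescaled and fed to the uniqueness of
    Lebesgue measure. *)
Definition pushforward_of : {measure set T2 -> \bar R} :=
  ltac:(unshelve refine [the {measure set T2 -> \bar R} of pushforward m f]; exact: mf).
End pushforward_measure.

Section one_dimensional.
Context (R : realType).
Local Notation mu := (@lebesgue_measure R).

Lemma measurable_affine1 (a b : R) :
  measurable_fun setT ((fun x => (a * x + b)%R) : measurableTypeR R -> measurableTypeR R).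
Proof. by apply: measurable_funD => //; apply: measurable_funM. Qed.

(** The scaled image measure agrees with Lebesgue measure on half-open intervals, and these
    determine it. For [a < 0] the preimage is closed at the other end, which does not affect its
    length. *)
Lemma lebesgue_measure_affine (a b : R) (A : set (measurableTypeR R)) : a != 0 ->
  measurable A ->
  mu A = (`|a|%:E * mu ((fun x => (a * x + b)%R : measurableTypeR R) @^-1` A))%E.
Proof.
move=> a0 mA.
have na0 : 0 <= `|a| by [].
transitivity (mscale (NngNum na0) (pushforward_of mu (measurable_affine1 a b)) A); last by [].
apply: lebesgue_measure_unique => //= _ [[c d]] _ <-.
rewrite /mscale /= /pushforward.
have [a_gt0|] := ltP 0 a.
- have -> : (fun x => (a * x + b)%R : measurableTypeR R) @^-1` `]c, d]%classic =
      `](c - b) / a, (d - b) / a]%classic.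
    apply/seteqP; split=> x /=; rewrite !in_itv /= ltr_pdivrMr// ler_pdivlMr//;
      by move=> /andP[? ?]; apply/andP; split; lra.
  rewrite !lebesgue_measure_itv /= !lte_fin.
  rewrite ltr_pM2r ?invr_gt0// ltrD2r.
  case: ifPn => _; last by rewrite mule0.
  rewrite gtr0_norm// -!EFinB -EFinM; congr EFin; field.
  by [].
- rewrite le_eqVlt (negbTE a0) /= => a_lt0.
  have -> : (fun x => (a * x + b)%R : measurableTypeR R) @^-1` `]c, d]%classic =
      `[(d - b) / a, (c - b) / a[%classic.
    apply/seteqP; split=> x /=; rewrite !in_itv /= ler_ndivrMr// ltr_ndivlMr//;
      by move=> /andP[? ?]; apply/andP; split; lra.
  rewrite !lebesgue_measure_itv /= !lte_fin.
  rewrite ltr_nM2r ?invr_lt0// ltrD2r.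
  case: ifPn => _; last by rewrite mule0.
  rewrite ltr0_norm// -!EFinB -EFinM; congr EFin; field.
  by [].
Qed.

Lemma ge0_integral_affine (a b : R) (f : measurableTypeR R -> \bar R) : a != 0 ->
  measurable_fun setT f -> (forall x, (0 <= f x)%E) ->
  (\int[mu]_x f x = `|a|%:E * \int[mu]_x f (a * x + b)%R)%E.
Proof.
move=> a0 mf f0.
have na0 : 0 <= `|a| by [].
have mphi := measurable_affine1 a b.
transitivity (\int[mscale (NngNum na0) (pushforward_of mu mphi)]_x f x)%E.
  by apply: eq_measure_integral => A mA _; exact: lebesgue_measure_affine.
rewrite ge0_integral_mscale//.
by rewrite ge0_integral_pushforward.
Qed.

End one_dimensional.

Section tuples.
Context (R : realType).
Local Notation mu := (@lebesgue_measure R).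
Local Notation X := (measurableTypeR R).
Local Notation L := (@lebesgueRn R).

Lemma ge0_integral_cons n (f : n.+1.-tuple X -> \bar R) :
  measurable_fun setT f -> (forall x, (0 <= f x)%E) ->
  (\int[L n.+1]_t f t = \int[mu \x L n]_z f (tcons z))%E.
Proof.
move=> mf f0.
transitivity (\int[pushforward (mu \x L n) (@tcons _ _ _)]_t f t)%E; first by [].
by rewrite ge0_integral_pushforward//; exact: measurable_tcons.
Qed.

(** The tail is integrated innermost here, the head in the next lemma: the change of variables uses
    this order for maps acting on the tail and the other one for maps acting on the head. *)
Lemma ge0_integral_consl n (f : n.+1.-tuple X -> \bar R) :
  measurable_fun setT f -> (forall x, (0 <= f x)%E) ->
  (\int[L n.+1]_t f t = \int[mu]_x \int[L n]_t f (tcons (x, t)))%E.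
Proof.
move=> mf f0; rewrite ge0_integral_cons//.
apply: (fubini_tonelli1 (m1 := mu) (m2 := L n) (f \o @tcons _ _ _)) => //=.
by apply: measurableT_comp => //; exact: measurable_tcons.
Qed.

Lemma ge0_integral_consr n (f : n.+1.-tuple X -> \bar R) :
  measurable_fun setT f -> (forall x, (0 <= f x)%E) ->
  (\int[L n.+1]_t f t = \int[L n]_t \int[mu]_x f (tcons (x, t)))%E.
Proof.
move=> mf f0; rewrite ge0_integral_cons//.
apply: (fubini_tonelli2 (m1 := mu) (m2 := L n) (f \o @tcons _ _ _)) => //=.
by apply: measurableT_comp => //; exact: measurable_tcons.
Qed.

End tuples.

Section affine_change_of_variables.
Context (R : realType).
Local Notation mu := (@lebesgue_measure R).
Local Notation X := (measurableTypeR R).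
Local Notation L := (@lebesgueRn R).

Definition tuple_of_row n (v : 'rV[R]_n) : n.-tuple X := [tuple v 0 i | i < n].

Lemma tuple_of_rowK n : cancel (@tuple_of_row n) (@row_of_tuple R n).
Proof. by move=> v; apply/rowP => i; rewrite !mxE tnth_mktuple. Qed.

Lemma row_of_tupleK n : cancel (@row_of_tuple R n) (@tuple_of_row n).
Proof. by move=> t; apply: eq_from_tnth => i; rewrite tnth_mktuple mxE. Qed.

Definition taffine n (A : 'M[R]_n) (b : 'rV[R]_n) (t : n.-tuple X) : n.-tuple X :=
  tuple_of_row (row_of_tuple t *m A + b).

Lemma measurable_tuple_of_row d (T : measurableType d) n (f : T -> 'rV[R]_n) :
  (forall i, measurable_fun setT (fun x => f x 0 i : X)) ->
  measurable_fun setT (fun x => tuple_of_row (f x)).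
Proof.
move=> mf; apply/measurable_fun_tnthP => i.
by apply: eq_measurable_fun (mf i) => x _ /=; rewrite tnth_mktuple.
Qed.

Lemma measurable_taffine n (A : 'M[R]_n) b : measurable_fun setT (taffine A b).
Proof.
apply: measurable_tuple_of_row => i.
under [X in measurable_fun _ X]eq_fun do rewrite !mxE.
apply: measurable_funD => //; apply: measurable_sum => j.
under [X in measurable_fun _ X]eq_fun do rewrite !mxE.
by apply: measurable_funM => //; exact: measurable_tnth.
Qed.

Lemma taffineM n (A B : 'M[R]_n) b t :
  taffine (A *m B) b t = taffine B b (taffine A 0 t).
Proof. by rewrite /taffine tuple_of_rowK addr0 mulmxA. Qed.

Lemma row_of_tcons n (x : X) (t : n.-tuple X) :
  row_of_tuple (tcons (x, t)) = row_mx x%:M (row_of_tuple t) :> 'rV[R]_(1 + n).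
Proof.
apply/rowP => i; rewrite !mxE.
case: splitP => j ij; rewrite !mxE.
  by rewrite ord1 eqxx mulr1n (tnth_nth x) ij ord1.
by rewrite !(tnth_nth x) ij.
Qed.

Lemma tuple_of_row_mx n (x : R) (v : 'rV[R]_n) :
  tuple_of_row (row_mx x%:M v : 'rV[R]_(1 + n)) = tcons (x : X, tuple_of_row v).
Proof.
by apply: (can_inj (@row_of_tupleK _)); rewrite row_of_tcons !tuple_of_rowK.
Qed.

Lemma row_mx1_split n (v : 'rV[R]_(1 + n)) :
  v = row_mx (v 0 ord0)%:M (@rsubmx _ _ 1 n v).
Proof.
rewrite -[LHS](@hsubmxK _ _ 1 n) [X in row_mx X _]mx11_scalar.
by congr (row_mx _%:M _); rewrite mxE; congr (v _ _); exact/val_inj.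
Qed.

(** The translation [b] is quantified inside because, once the head is fixed, the tail is shifted by
    an amount depending on it; the induction on the dimension must cover every shift. *)
Definition transports n (A : 'M[R]_n) := forall b (f : n.-tuple X -> \bar R),
  measurable_fun setT f -> (forall t, (0 <= f t)%E) ->
  (\int[L n]_t f t = `|\det A|%:E * \int[L n]_t f (taffine A b t))%E.

Lemma transportsM n (A B : 'M[R]_n) : transports A -> transports B -> transports (A *m B).
Proof.
move=> tA tB b f mf f0; rewrite (tB b)// (tA 0 (f \o taffine B b)) //=; last first.
  by apply: measurableT_comp => //; exact: measurable_taffine.
rewrite muleA -EFinM -normrM -det_mulmx det_mulmx mulrC -det_mulmx.
by under [in RHS]eq_integral do rewrite taffineM.
Qed.

Lemma measurable_consl n (f : n.+1.-tuple X -> \bar R) : measurable_fun setT f ->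
  forall x : X, measurable_fun setT (fun t => f (tcons (x, t))).
Proof.
move=> mf x; apply: measurableT_comp => //; apply: measurableT_comp => //.
exact: measurable_tcons.
Qed.

Lemma measurable_consr n (f : n.+1.-tuple X -> \bar R) : measurable_fun setT f ->
  forall t : n.-tuple X, measurable_fun setT (fun x => f (tcons (x, t))).
Proof.
move=> mf x; apply: measurableT_comp => //; apply: measurableT_comp => //.
exact: measurable_tcons.
Qed.

Lemma measurable_integral_consr n (f : n.+1.-tuple X -> \bar R) :
  measurable_fun setT f -> (forall t, (0 <= f t)%E) ->
  measurable_fun setT (fun t => \int[mu]_x f (tcons (x, t)))%E.
Proof.
move=> mf f0.
apply: (measurable_fun_fubini_tonelli_G (m1 := mu) (f \o @tcons _ _ _)) => //=.
by apply: measurableT_comp => //; exact: measurable_tcons.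
Qed.

Lemma measurable_integral_consl n (f : n.+1.-tuple X -> \bar R) :
  measurable_fun setT f -> (forall t, (0 <= f t)%E) ->
  measurable_fun setT (fun x => \int[L n]_t f (tcons (x, t)))%E.
Proof.
move=> mf f0.
apply: (measurable_fun_fubini_tonelli_F (m2 := L n) (f \o @tcons _ _ _)) => //=.
by apply: measurableT_comp => //; exact: measurable_tcons.
Qed.

Lemma taffine_block n (a b0 : R) (B b1 : 'rV[R]_n) C D (x : X) (t : n.-tuple X) :
  taffine (block_mx a%:M B C D : 'M[R]_(1 + n)) (row_mx b0%:M b1) (tcons (x, t)) =
  tcons (a * x + ((row_of_tuple t *m C) 0 0 + b0) : X, taffine D (x *: B + b1) t).
Proof.
rewrite /taffine row_of_tcons -tuple_of_row_mx mul_row_block add_row_mx.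
congr (tuple_of_row (row_mx _ _)).
  by apply/rowP => i; rewrite !ord1 !mxE big_ord1 !mxE eqxx !mulr1n mulrC addrA.
by rewrite mul_scalar_mx addrA [x *: B + _]addrC.
Qed.

(** With row vectors, the matrix sends [(x, t)] to [(a x + t C, t)]: for a fixed tail this is a
    one-dimensional affine map. The hypothesis on the identity matrix is translation invariance in
    the tail. *)
Lemma transports_first n (a : R) (C : 'cV[R]_n) : a != 0 ->
  transports (1%:M : 'M[R]_n) -> transports (block_mx a%:M 0 C 1%:M : 'M[R]_(1 + n)).
Proof.
move=> a0 t1 b f mf f0.
have -> : \det (block_mx a%:M 0 C 1%:M : 'M[R]_(1 + n)) = a.
  by rewrite det_lblock det1 mulr1 det_scalar expr1.
have mfA := measurableT_comp mf (measurable_taffine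
  (block_mx a%:M 0 C 1%:M : 'M[R]_(1 + n)) b).
rewrite !ge0_integral_consr//.
pose b0 := b 0 ord0; pose b1 : 'rV[R]_n := @rsubmx _ _ 1 n b.
have bE : b = row_mx b0%:M b1 by exact: row_mx1_split.
rewrite (t1 b1); last 2 first.
- exact: measurable_integral_consr.
- by move=> t; exact: integral_ge0.
rewrite det1 normr1 mul1e -ge0_integralZl//=; last 2 first.
- by apply: (measurable_integral_consr mfA) => t /=; exact: f0.
- by move=> t _; exact: integral_ge0.
apply: eq_integral => t _.
rewrite (@ge0_integral_affine _ a ((row_of_tuple t *m C) 0 0 + b0))//; last first.
  exact: measurable_consr.
by congr (_ * _)%E; apply: eq_integral => x _; rewrite bE taffine_block scaler0 add0r.
Qed.

(** The matrix sends [(x, t)] to [(x, x B + t D)]: for a fixed head, the tail undergoes [D] followed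
    by a translation. *)
Lemma transports_rest n (B : 'rV[R]_n) (D : 'M[R]_n) :
  transports D -> transports (block_mx 1%:M B 0 D : 'M[R]_(1 + n)).
Proof.
move=> tD b f mf f0.
have -> : \det (block_mx 1%:M B 0 D : 'M[R]_(1 + n)) = \det D.
  by rewrite det_ublock det1 mul1r.
have mfA := measurableT_comp mf (measurable_taffine
  (block_mx 1%:M B 0 D : 'M[R]_(1 + n)) b).
rewrite !ge0_integral_consl//.
pose b0 := b 0 ord0; pose b1 : 'rV[R]_n := @rsubmx _ _ 1 n b.
have bE : b = row_mx b0%:M b1 by exact: row_mx1_split.
rewrite (@ge0_integral_affine _ 1 b0)//; last 2 first.
- exact: measurable_integral_consl.
- by move=> t; exact: integral_ge0.
rewrite normr1 mul1e -ge0_integralZl//=; last 2 first.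
- by apply: (measurable_integral_consl mfA) => t /=; exact: f0.
- by move=> t _; exact: integral_ge0.
apply: eq_integral => x _.
rewrite (tD (x *: B + b1))//; last exact: measurable_consl.
congr (_ * _)%E; apply: eq_integral => t _.
by rewrite bE taffine_block mulmx0 mxE add0r.
Qed.

Lemma row'_first n m (u v : 'M[R]_(1, m)) (A : 'M[R]_(n, m)) :
  row' (lshift n ord0) (col_mx u A) = row' (lshift n ord0) (col_mx v A).
Proof.
apply/matrixP => i j; rewrite [LHS]mxE [RHS]mxE.
have -> : lift (lshift n ord0) i = rshift 1 (i : 'I_n) by exact/val_inj.
by rewrite !col_mxEd.
Qed.

(** Multilinearity in the first column, which is [a + 1] times the column [(1, 0)] minus the column
    [(1, - C)]. It shows that [D] and [D + C *m B] cannot both be singular when the block matrix is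
    invertible. *)
Lemma det_block_shear n (a : R) (B : 'rV[R]_n) (C : 'cV[R]_n) (D : 'M[R]_n) :
  \det (block_mx a%:M B C D) = (a + 1) * \det D - \det (D + C *m B).
Proof.
have -> : \det D = \det (block_mx (1%:M : 'M[R]_1) B 0 D).
  by rewrite det_ublock det1 mul1r.
have -> : \det (D + C *m B) = \det (block_mx (1%:M : 'M[R]_1) B (- C) D).
  have -> : block_mx (1%:M : 'M[R]_1) B (- C) D =
      block_mx (1%:M : 'M[R]_1) 0 (- C) 1%:M *m block_mx 1%:M B 0 (D + C *m B).
    rewrite mulmx_block !mul1mx !mul0mx !addr0 mulmx1 mulNmx.
    by rewrite addrCA addNr addr0.
  by rewrite det_mulmx det_lblock det_ublock !det1 !mul1r.
rewrite -det_tr -[X in (a + 1) * X]det_tr -[X in _ - X]det_tr !tr_block_mx.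
rewrite -mulN1r; apply: (@determinant_multilinear _ _ _ _ _ (lshift _ ord0)).
- rewrite !rowKu !row_id scale_row_mx scale_row_mx add_row_mx raddfN /= !trmx0 trmx1.
  rewrite scalerN scaler0 add0r !scaleN1r opprK tr_scalar_mx scale_scalar_mx.
  by rewrite mulr1 -raddfB /= addrK.
- exact: row'_first.
- exact: row'_first.
Qed.

(** Induction on the dimension. When [D] is invertible, elimination through the Schur complement
    factors the matrix into a map acting on the tail and one acting on the head. *)
Lemma transports_unit n (A : 'M[R]_n) : A \in unitmx -> transports A.
Proof.
elim: n A => [|n IHn] A uA.
  move=> b f mf f0; rewrite det_mx00 normr1 mul1e; apply: eq_integral => t _.
  by congr f; rewrite tuple0 [RHS]tuple0.
have t1 := IHn _ (unitmx1 R n).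
have schur (a : R) (B : 'rV[R]_n) C (D : 'M[R]_n) : D \in unitmx ->
    block_mx a%:M B C D \in unitmx -> transports (block_mx a%:M B C D : 'M[R]_(1 + n)).
  move=> uD uM; pose s := B *m invmx D *m C; pose a' := a - s 0 0.
  have ME : block_mx a%:M B C D =
      block_mx 1%:M B 0 D *m block_mx a'%:M 0 (invmx D *m C) 1%:M.
    rewrite mulmx_block !mul1mx !mul0mx !mulmx1 !add0r.
    rewrite !mulmxA mulmxV// mul1mx -/s [s]mx11_scalar -raddfD /= subrK.
    by [].
  have a'0 : a' != 0.
    move: uM; rewrite ME unitmx_mul !unitmxE => /andP[_].
    by rewrite det_lblock det1 mulr1 det_scalar expr1 unitfE.
  rewrite ME; apply: transportsM; first exact/transports_rest/IHn.
  exact: transports_first.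
pose a := A 0 0; pose B : 'rV[R]_n := @ursubmx _ 1 n 1 n A.
pose C : 'cV[R]_n := @dlsubmx _ 1 n 1 n A; pose D : 'M[R]_n := @drsubmx _ 1 n 1 n A.
have AE : A = block_mx a%:M B C D.
  rewrite -[LHS](@submxK _ 1 n 1 n) [ulsubmx _]mx11_scalar.
  suff -> : @ulsubmx _ 1 n 1 n A 0 0 = a by [].
  by rewrite !mxE; congr (A _ _); exact/val_inj.
rewrite AE in uA *.
have [uD|] := boolP (D \in unitmx); first exact: schur.
rewrite unitmxE unitfE negbK => /eqP D0.
(* When [D] is singular, a shear is split off so that [D] becomes [D + C *m B], which
   [det_block_shear] shows to be invertible. *)
pose E := block_mx (1%:M : 'M[R]_1) 0 (- C) 1%:M.
have : block_mx a%:M B C D = E *m block_mx a%:M B (C + C *m a%:M) (D + C *m B).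
  rewrite mulmx_block !mul1mx !mul0mx !addr0 !mulNmx addrCA addNr addr0.
  by rewrite addrC addrK.
move=> ME; rewrite ME in uA *.
apply: transportsM; first by rewrite /E; exact: transports_first.
apply: schur; last by move: uA; rewrite unitmx_mul => /andP[].
rewrite unitmxE unitfE; apply/eqP => DCB.
move: uA; rewrite -ME unitmxE det_block_shear D0 DCB.
by rewrite mulr0 subr0 unitr0.
Qed.

End affine_change_of_variables.

(** * Integrals of polynomial functions *)

Section polynomial_functions.
Context (R : realType).
Local Notation X := (measurableTypeR R).
Local Notation L := (@lebesgueRn R).

(** Generated as an algebra, so that measurability, continuity, bounds and restriction to lines are
    inductions with four cases. *)
Inductive polyfun n : ('rV[R]_n -> R) -> Prop :=
| polyfun_cst c : polyfun (fun=> c)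
| polyfun_coord i : polyfun (fun x => x 0 i)
| polyfunD f g : polyfun f -> polyfun g -> polyfun (fun x => f x + g x)
| polyfunM f g : polyfun f -> polyfun g -> polyfun (fun x => f x * g x).

Lemma polyfun_sum n (I : Type) (r : seq I) (P : pred I) (F : I -> 'rV[R]_n -> R) :
  (forall i, polyfun (F i)) -> polyfun (fun x => \sum_(i <- r | P i) F i x).
Proof.
move=> pF; elim: r => [|i r IHr].
  rewrite (_ : (fun _ => _) = fun=> 0); first exact: polyfun_cst.
  by apply/funext => x; rewrite big_nil.
have [Pi|/negbTE nPi] := boolP (P i).
  rewrite (_ : (fun _ => _) = fun x => F i x + \sum_(j <- r | P j) F j x).
    exact: polyfunD.
  by apply/funext => x; rewrite big_cons Pi.
by rewrite (_ : (fun _ => _) = fun x => \sum_(j <- r | P j) F j x)//;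
  apply/funext => x; rewrite big_cons nPi.
Qed.

Lemma polyfunN n (f : 'rV[R]_n -> R) : polyfun f -> polyfun (fun x => - f x).
Proof.
move=> pf; rewrite (_ : (fun _ => _) = fun x => -1 * f x).
  by apply: polyfunM => //; exact: polyfun_cst.
by apply/funext => x; rewrite mulN1r.
Qed.

Lemma polyfunB n (f g : 'rV[R]_n -> R) : polyfun f -> polyfun g ->
  polyfun (fun x => f x - g x).
Proof. by move=> pf pg; apply: polyfunD => //; exact: polyfunN. Qed.

Lemma polyfun_comp m n (phi : 'rV[R]_m -> 'rV[R]_n) (f : 'rV[R]_n -> R) :
  (forall i, polyfun (fun x => phi x 0 i)) -> polyfun f -> polyfun (f \o phi).
Proof.
move=> pphi; elim => [c|i|{}f g _ pf _ pg|{}f g _ pf _ pg].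
- exact: polyfun_cst.
- exact: pphi.
- exact: polyfunD pf pg.
- exact: polyfunM pf pg.
Qed.

Lemma polyfun_affine_coord m n (a : 'rV[R]_n) (A : 'M[R]_(m, n)) i :
  polyfun (fun x => (a + x *m A) 0 i).
Proof.
rewrite (_ : (fun _ => _) = fun x : 'rV_m => a 0 i + \sum_j x 0 j * A j i).
  apply: polyfunD; first exact: polyfun_cst.
  apply: polyfun_sum => j; apply: polyfunM; first exact: polyfun_coord.
  exact: polyfun_cst.
by apply/funext => x; rewrite !mxE.
Qed.

Lemma polyfun_affine m n (a : 'rV[R]_n) (A : 'M[R]_(m, n)) (f : 'rV[R]_n -> R) :
  polyfun f -> polyfun (fun x => f (a + x *m A)).
Proof. by apply: polyfun_comp => i; exact: polyfun_affine_coord. Qed.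

Lemma polyfun_line n (f : 'rV[R]_n -> R) (x e : 'rV[R]_n) : polyfun f ->
  exists q : {poly R}, forall s, f (x + s *: e) = q.[s].
Proof.
elim=> [c|i|{}f g _ [q qf] _ [r rg]|{}f g _ [q qf] _ [r rg]].
- by exists c%:P => s; rewrite hornerC.
- by exists ((x 0 i)%:P + 'X * (e 0 i)%:P) => s; rewrite !hornerE !mxE.
- by exists (q + r) => s; rewrite hornerD qf rg.
- by exists (q * r) => s; rewrite hornerM qf rg.
Qed.

Lemma measurable_polyfun n (f : 'rV[R]_n -> R) : polyfun f ->
  measurable_fun setT (f \o @row_of_tuple R n).
Proof.
elim=> [c|i|{}f g _ pf _ pg|{}f g _ pf _ pg].
- exact: measurable_cst.
- rewrite (_ : _ \o _ = (fun t => tnth t i : X)); first exact: measurable_tnth.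
  by apply/funext => t /=; rewrite mxE.
- exact: measurable_funD pf pg.
- exact: measurable_funM pf pg.
Qed.

Lemma polyfun_bounded n (f : 'rV[R]_n -> R) (r : R) : polyfun f ->
  exists M, forall x : 'rV[R]_n, (forall i, `|x 0 i| <= r) -> `|f x| <= M.
Proof.
elim=> [c|i|{}f g _ [M Mf] _ [N Ng]|{}f g _ [M Mf] _ [N Ng]].
- by exists `|c|.
- by exists r.
- exists (M + N) => x xr; apply: le_trans (ler_normD _ _) _.
  by rewrite lerD ?Mf ?Ng.
- by exists (M * N) => x xr; rewrite normrM ler_pM ?Mf ?Ng.
Qed.

Lemma polyfun_continuous n (f : 'rV[R]_n -> R) : polyfun f -> continuous f.
Proof.
elim=> [c|i|{}f g _ pf _ pg|{}f g _ pf _ pg] x.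
- exact: cst_continuous.
- exact: coord_continuous.
- exact: (continuousD (pf x) (pg x)).
- exact: (continuousM (pf x) (pg x)).
Qed.

Definition box n (x : 'rV[R]_n) (e : R) : set (n.-tuple X) :=
  [set t | forall i, ball (x 0 i) e (tnth t i)].

Lemma measurable_box n x e : measurable (@box n x e).
Proof.
rewrite (_ : box _ _ = \bigcap_(i in setT) ((fun t => tnth t i) @^-1` ball (x 0 i) e)).
  apply: fin_bigcap_measurable => // i _; rewrite -[X in measurable X]setTI.
  by apply: measurable_tnth => //; exact: measurable_ball.
by apply/seteqP; split => t tb i => [_|]; exact: tb.
Qed.

Lemma lebesgueRn_box n (x : 'rV[R]_n) e : 0 <= e ->
  L n (box x e) = ((e *+ 2) ^+ n)%:E.
Proof.
move=> e0; elim: n x => [|n IHn] x.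
  rewrite expr0 /= diracE mem_set//= => -[] //.
transitivity ((@lebesgue_measure R \x L n)%E (@tcons _ _ _ @^-1` box x e)); first by [].
have -> : @tcons _ _ _ @^-1` box x e =
   ball (x 0 ord0) e `*` box (\row_i x 0 (lift ord0 i)) e.
  apply/seteqP; split => -[y t] /=.
    move=> yt; split; first exact: (yt ord0).
    by move=> i; rewrite mxE; have := yt (lift ord0 i); rewrite tnthS.
  move=> [yb tb] i; case: (unliftP ord0 i) => [j ->|->]; last exact: yb.
  by rewrite tnthS; have := tb j; rewrite mxE.
rewrite product_measure1E//; [|exact: measurable_ball|exact: measurable_box].
by rewrite IHn exprS EFinM -[X in (_ = X * _)%E](lebesgue_measure_ball (x 0 ord0) e0).
Qed.

Definition row_integral n (D : set 'rV[R]_n) (f : 'rV[R]_n -> R) : R :=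
  \int[L n]_(t in @row_of_tuple R n @^-1` D) f (row_of_tuple t).

Definition row_measurable n (D : set 'rV[R]_n) := measurable (@row_of_tuple R n @^-1` D).

Definition row_bounded n (D : set 'rV[R]_n) :=
  exists r, forall x, D x -> forall i, `|x 0 i| <= r.

Lemma row_bounded_fin n (D : set 'rV[R]_n) : row_measurable D -> row_bounded D ->
  (L n (@row_of_tuple R n @^-1` D) < +oo)%E.
Proof.
move=> mD [r Dr].
(* The absolute value is there because [r] may be negative when [D] is empty, the added 1 because
   balls are open. *)
apply: (@le_lt_trans _ _ (L n (box 0 (`|r| + 1)))); last first.
  by rewrite lebesgueRn_box ?addr_ge0// ltry.
apply: le_measure; rewrite ?inE//; first exact: measurable_box.
move=> t /= /Dr tr i; rewrite mxE /ball /= sub0r normrN.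
rewrite (le_lt_trans _ (ltr_pwDr _ (ler_norm r)))//.
by have := tr i; rewrite mxE.
Qed.

Lemma polyfun_integrable n (D : set 'rV[R]_n) f : row_measurable D -> row_bounded D ->
  polyfun f ->
  (L n).-integrable (@row_of_tuple R n @^-1` D) (EFin \o (f \o @row_of_tuple R n)).
Proof.
move=> mD bD pf; apply: measurable_bounded_integrable => //.
- exact: row_bounded_fin.
- exact: measurable_funTS (measurable_polyfun pf).
have [r Dr] := bD; have [M Mf] := polyfun_bounded r pf.
exists M; split; first exact: num_real.
by move=> N MN t /= Dt; apply: le_trans (ltW MN); apply: Mf; exact: Dr.
Qed.

Lemma row_integralD n (D : set 'rV[R]_n) f g : row_measurable D -> row_bounded D ->
  polyfun f -> polyfun g ->
  row_integral D (fun x => f x + g x) = row_integral D f + row_integral D g.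
Proof.
by move=> mD bD pf pg; rewrite /row_integral RintegralD//; exact: polyfun_integrable.
Qed.

Lemma row_integralZ n (D : set 'rV[R]_n) c f : row_measurable D -> row_bounded D ->
  polyfun f -> row_integral D (fun x => c * f x) = c * row_integral D f.
Proof.
by move=> mD bD pf; rewrite /row_integral RintegralZl//; exact: polyfun_integrable.
Qed.

Lemma eq_row_integral n (D : set 'rV[R]_n) f g : (forall x, D x -> f x = g x) ->
  row_integral D f = row_integral D g.
Proof. by move=> fg; apply: eq_Rintegral => t; rewrite inE => /fg. Qed.

Lemma row_integral_ge0 n (D : set 'rV[R]_n) f :
  (forall x, D x -> 0 <= f x) -> 0 <= row_integral D f.
Proof. by move=> f0; apply: Rintegral_ge0 => t /f0. Qed.

(** A positive value at an interior point persists, up to a factor one half, on a box, and boxes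
    have positive measure. *)
Lemma row_integral_eq0 n (D : set 'rV[R]_n) f : row_measurable D -> row_bounded D ->
  polyfun f -> (forall x, D x -> 0 <= f x) -> row_integral D f = 0 ->
  forall x, nbhs x D -> f x = 0.
Proof.
move=> mD bD pf f0 If x Dx; apply/eqP/negPn/negP => fx0.
have fx_gt0 : 0 < f x by rewrite lt_neqAle eq_sym fx0 f0//; exact: nbhs_singleton.
have /(polyfun_continuous pf) fx2 : nbhs (f x) [set z | f x / 2 < z].
  by apply: lt_nbhsr; rewrite ltr_pdivrMr// ltr_pMr// ltr1n.
have : \forall y \near x, D y /\ f x / 2 < f y by exact: filterI.
move=> /nbhs_ballP[e /= e0 eD].
have : (0 < \int[L n]_(t in @row_of_tuple R n @^-1` D) (f (row_of_tuple t))%:E)%E.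
  apply: (@lt_le_trans _ _ (\int[L n]_(t in box x e) (f x / 2)%:E)%E).
    rewrite integral_cst//; last exact: measurable_box.
    rewrite [X in (_ < _ * X)%E](lebesgueRn_box x (ltW e0)).
    by rewrite -EFinM lte_fin mulr_gt0// ?divr_gt0// exprn_gt0// mulrn_wgt0.
  have boxD t : box x e t -> ball x e (row_of_tuple t).
    by move=> bt; split => // i j; rewrite !ord1 mxE; exact: bt.
  apply: (@le_trans _ _ (\int[L n]_(t in box x e) (f (row_of_tuple t))%:E)%E).
    apply: ge0_le_integral => //.
    - exact: measurable_box.
    - by move=> t _; rewrite lee_fin ltW// divr_gt0.
    - by apply/measurable_EFinP/measurable_funTS; exact: measurable_polyfun.
    - by move=> t /boxD /eD[_ /ltW]; rewrite lee_fin.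
  apply: ge0_subset_integral => //.
  - exact: measurable_box.
  - by apply/measurable_EFinP/measurable_funTS; exact: measurable_polyfun.
  - by move=> t /f0; rewrite lee_fin.
  - by move=> t /boxD /eD[].
rewrite -(fineK (integrable_fin_num _ (polyfun_integrable mD bD pf)))//.
by rewrite -/(Rintegral _ _ _) -/(row_integral D f) If ltxx.
Qed.

End polynomial_functions.

(** * Integration on the unit simplex *)

Section reference_simplex.
Context (R : realType).
Local Notation X := (measurableTypeR R).
Local Notation L := (@lebesgueRn R).
Local Notation mu := (@lebesgue_measure R).
Local Notation Delta n := (@unit_simplex R n).

Lemma row_measurable_unit_simplex n : row_measurable (Delta n).
Proof.
rewrite /row_measurable (_ : _ @^-1` _ =
    (\bigcap_(i in [set: 'I_n]) ((fun t : n.-tuple X => row_of_tuple t 0 i) @^-1` `[0, +oo[)) `&`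
    ((fun t : n.-tuple X => \sum_i row_of_tuple t 0 i) @^-1` `]-oo, 1])).
  apply: measurableI.
    apply: fin_bigcap_measurable => // i _; rewrite -[X in measurable X]setTI.
    exact: (measurable_polyfun (polyfun_coord R i) measurableT (measurable_itv _)).
  rewrite -[X in measurable X]setTI.
  exact: (measurable_polyfun (polyfun_sum _ _ (@polyfun_coord R n)) measurableT (measurable_itv _)).
apply/seteqP; split => t /=.
  move=> [t0 t1]; split; last by rewrite in_itv.
  by move=> i _ /=; rewrite in_itv /= t0.
move=> [t0 t1]; split; last by move: t1; rewrite in_itv.
by move=> i; have := t0 i Logic.I; rewrite /= in_itv /= andbT.
Qed.

Lemma row_bounded_unit_simplex n : row_bounded (Delta n).
Proof.
exists 1 => x [x0 x1] i; rewrite ger0_norm//.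
apply: le_trans x1; rewrite (bigD1 i)//= lerDl sumr_ge0//.
Qed.
Hint Resolve row_measurable_unit_simplex row_bounded_unit_simplex : core.

Lemma mem_preimageE (T U : Type) (f : T -> U) (D : set U) t :
  (t \in f @^-1` D) = (f t \in D).
Proof. by apply/idP/idP; rewrite !inE. Qed.

Lemma integral_taffine n (A : 'M[R]_n) b (h : n.-tuple X -> \bar R) : A \in unitmx ->
  (L n).-integrable setT h ->
  (\int[L n]_t h (taffine A b t) = `|\det A|^-1%:E * \int[L n]_t h t)%E.
Proof.
move=> uA ih; have mh := measurable_int _ ih.
have d0 : \det A != 0 by move: uA; rewrite unitmxE unitfE.
have pos (k : n.-tuple X -> \bar R) : measurable_fun setT k -> (forall t, (0 <= k t)%E) ->
  (\int[L n]_t k (taffine A b t) = `|\det A|^-1%:E * \int[L n]_t k t)%E.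
  move=> mk k0; rewrite [in RHS](transports_unit uA b mk k0) muleA -EFinM mulVf ?mul1e//.
  by rewrite normr_eq0.
rewrite [in LHS]integralE [in RHS]integralE.
under eq_integral do rewrite (funepos_comp h).
rewrite pos//; last exact: measurable_funepos.
under [X in (_ - X)%E]eq_integral do rewrite (funeneg_comp h).
rewrite pos//; last exact: measurable_funeneg.
rewrite [RHS]muleBr//; apply: fin_num_adde_defl; rewrite fin_numN.
exact: integrable_neg_fin_num.
Qed.

Lemma row_measurable_affine n (A : 'M[R]_n) (b : 'rV[R]_n) D : A \in unitmx ->
  row_measurable D -> row_measurable ((fun x => b + x *m A) @` D).
Proof.
move=> uA mD; rewrite /row_measurable (_ : _ @^-1` _ =
   taffine (invmx A) (- b *m invmx A) @^-1` (@row_of_tuple R n @^-1` D)).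
  by rewrite -[X in measurable X]setTI; exact: measurable_taffine.
apply/seteqP; split => t /=; rewrite /taffine tuple_of_rowK.
  move=> [x Dx <-]; rewrite -mulmxDl addrAC subrr add0r.
  by rewrite mulmxK.
move=> Dt; exists (row_of_tuple t *m invmx A + - b *m invmx A) => //.
by rewrite -mulmxDl mulmxKV// addrC subrK.
Qed.

Lemma row_bounded_affine m n (A : 'M[R]_(m, n)) (b : 'rV[R]_n) D :
  row_bounded D -> row_bounded ((fun x => b + x *m A) @` D).
Proof.
move=> [r Dr].
have bd i : exists M, forall x : 'rV[R]_m, (forall i, `|x 0 i| <= r) ->
  `|(b + x *m A) 0 i| <= M by exact/polyfun_bounded/polyfun_affine_coord.
pose M := fun i => projT1 (cid (bd i)).
exists (\sum_i `|M i|) => _ [x Dx <-] i.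
have := projT2 (cid (bd i)) x (Dr _ Dx); rewrite -/(M i) => /le_trans; apply.
by apply: le_trans (ler_norm _) _; rewrite (bigD1 i)//= lerDl sumr_ge0.
Qed.

Lemma row_integral_affine n (A : 'M[R]_n) (b : 'rV[R]_n) D f : A \in unitmx ->
  row_measurable D -> row_bounded D -> polyfun f ->
  row_integral ((fun x => b + x *m A) @` D) f =
  `|\det A| * row_integral D (fun x => f (b + x *m A)).
Proof.
move=> uA mD bD pf.
have d0 : \det A != 0 by move: uA; rewrite unitmxE unitfE.
set D' := _ @` D.
have mD' : row_measurable D' by exact: row_measurable_affine.
have bD' : row_bounded D' by exact: row_bounded_affine.
(* Extension by zero moves the integral to the whole space, where the change of variables is
   available. *)
pose h := (EFin \o (f \o @row_of_tuple R n)) \_ (@row_of_tuple R n @^-1` D').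
have ih : (L n).-integrable setT h.
  by apply/(integrable_mkcond _ mD'); exact: polyfun_integrable.
have hI : (row_integral D' f)%:E = (\int[L n]_t h t)%E.
  rewrite /row_integral /Rintegral fineK; first by rewrite integral_mkcond.
  exact: integrable_fin_num (polyfun_integrable mD' bD' pf).
have hphi t : h (taffine A b t) =
    ((EFin \o ((fun x => f (b + x *m A)) \o @row_of_tuple R n)) \_ (@row_of_tuple R n @^-1` D)) t.
  rewrite /h /patch (mem_preimageE _ D') (mem_preimageE _ D) /taffine tuple_of_rowK.
  have -> : (row_of_tuple t *m A + b \in D') = (row_of_tuple t \in D).
    apply/idP/idP; rewrite !inE.
      move=> [x Dx]; rewrite addrC => /addIr /(can_inj (mulmxK uA)) <- //.
    by move=> Dt; exists (row_of_tuple t) => //; rewrite addrC.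
  by rewrite /= tuple_of_rowK addrC.
have := integral_taffine b uA ih; rewrite -hI.
under eq_integral do rewrite hphi.
rewrite -integral_mkcond -EFinM => hD.
have -> : row_integral D (fun x => f (b + x *m A)) = `|\det A|^-1 * row_integral D' f.
  exact: (congr1 fine hD).
by rewrite mulVKf// normr_eq0.
Qed.

Definition row_cons n (s : R) (t : 'rV[R]_n) : 'rV[R]_n.+1 := row_mx s%:M t : 'rV_(1 + n).

Lemma row_cons0 n s (t : 'rV[R]_n) : row_cons s t 0 0 = s.
Proof.
have := row_mxEl (s%:M : 'M[R]_1) t 0 0; rewrite [RHS]mxE eqxx mulr1n => e; rewrite -[RHS]e.
by rewrite /row_cons; congr (fun_of_matrix _ _ _); apply: val_inj.
Qed.

Lemma row_consS n s (t : 'rV[R]_n) i : row_cons s t 0 (lift ord0 i) = t 0 i.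
Proof.
have := row_mxEr (s%:M : 'M[R]_1) t 0 i => <-.
by rewrite /row_cons; congr (fun_of_matrix _ _ _); apply: val_inj.
Qed.

Lemma unit_simplex_cons n s (t : 'rV[R]_n) :
  Delta n.+1 (row_cons s t) <-> Delta n t /\ 0 <= s <= 1 - \sum_i t 0 i.
Proof.
have stE : \sum_i row_cons s t 0 i = s + \sum_i t 0 i.
  by rewrite big_ord_recl row_cons0; congr (_ + _); apply: eq_bigr => i _; rewrite row_consS.
rewrite /unit_simplex /= stE.
split => [[st0 st1]|[[t0 t1] /andP[s0 s1]]].
  have s0 : 0 <= s by have := st0 0; rewrite row_cons0.
  split; last by rewrite s0 /= lerBrDr.
  split; last by apply: le_trans st1; rewrite lerDr.
  by move=> i; have := st0 (lift ord0 i); rewrite row_consS.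
split; last by rewrite -lerBrDr.
move=> i; case: (unliftP ord0 i) => [j ->|->]; first by rewrite row_consS.
by rewrite row_cons0.
Qed.

Lemma Rintegral_deriv_poly (q : {poly R}) (b : R) : 0 <= b ->
  (\int[mu]_(x in `[0%R, b]) (q^`().[x])%:E = (q.[b] - q.[0])%:E)%E.
Proof.
rewrite le_eqVlt => /predU1P[<-|b0].
  by rewrite subrr set_itv1 integral_set1.
rewrite (@continuous_FTC2 _ (horner q^`()) (horner q))// ?EFinB//.
- exact/continuous_subspaceT/continuous_horner.
- split => [x _||].
  + exact: derivable_horner.
  + exact/cvg_at_right_filter/continuous_horner.
  + exact/cvg_at_left_filter/continuous_horner.
- by move=> x _; rewrite derivE.
Qed.

(* Fubini and the fundamental theorem of calculus in the first coordinate *)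
Lemma row_integral_unit_simplex_deriv n (f g : 'rV[R]_n.+1 -> R) : polyfun f -> polyfun g ->
  (forall x, exists q : {poly R}, forall s,
     f (x + s *: delta_mx 0 0) = q.[s] /\ g (x + s *: delta_mx 0 0) = q^`().[s]) ->
  row_integral (Delta n.+1) g =
  row_integral (Delta n) (fun t => f (row_cons (1 - \sum_i t 0 i) t) - f (row_cons 0 t)).
Proof.
move=> pf pg fg.
pose h := (EFin \o (g \o @row_of_tuple R n.+1)) \_ (@row_of_tuple R n.+1 @^-1` Delta n.+1).
have mDelta := @row_measurable_unit_simplex n.+1.
have ih : (L n.+1).-integrable setT h.
  by apply/(integrable_mkcond _ mDelta); exact: polyfun_integrable.
have mh := measurable_int _ ih.
(* Integrability on the product comes from Tonelli applied to the absolute value. *)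
have ih' : (mu \x L n)%E.-integrable setT (h \o @tcons _ _ _).
  apply/integrableP; split; first by apply: measurableT_comp => //; exact: measurable_tcons.
  have [_] := integrableP _ _ _ ih.
  by rewrite ge0_integral_cons//; exact: measurableT_comp.
rewrite /row_integral /Rintegral; congr fine; rewrite integral_mkcond.
transitivity (\int[mu \x L n]_z (h (tcons z)))%E.
  exact: (integral_pushforward (@measurable_tcons _ X n) mh ih' measurableT).
rewrite -(integral21_prod_meas1 ih') [RHS]integral_mkcond.
apply: eq_integral => t _.
rewrite /patch /= mem_preimageE; case: ifPn => [|tD]; last first.
  apply: integral0_eq => x _ /=; rewrite /h /patch mem_preimageE row_of_tcons.
  case: ifPn => //; rewrite inE => /unit_simplex_cons[Dt _].
  by move: tD; rewrite notin_setE.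
rewrite inE => Dt.
(* The slice of the simplex over [t] is an interval whose upper end is what the coordinates of [t]
   leave of 1. *)
transitivity (\int[mu]_(x in `[0%R, (1 - \sum_i row_of_tuple t 0 i)%R])
   (g (row_cons x (row_of_tuple t)))%:E)%E.
  rewrite [RHS]integral_mkcond; apply: eq_integral => x _.
  rewrite /h /patch /= mem_preimageE row_of_tcons.
  congr (if _ then _ else _); apply/idP/idP; rewrite !inE /= in_itv /=.
    by move=> /unit_simplex_cons[].
  by move=> xb; apply/unit_simplex_cons.
have [q qfg] := fg (row_cons 0 (row_of_tuple t)).
have consE s : row_cons 0 (row_of_tuple t) + s *: delta_mx 0 0 = row_cons s (row_of_tuple t).
  apply/rowP => i; rewrite mxE [X in _ + X]mxE [X in _ * X]mxE.
  case: (unliftP ord0 i) => [j ->|->]; first by rewrite !row_consS mulr0 addr0.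
  by rewrite !row_cons0 eqxx mulr1 add0r.
under eq_integral do rewrite -consE (qfg _).2.
by rewrite Rintegral_deriv_poly ?subr_ge0 ?Dt.2// -!(qfg _).1 !consE.
Qed.

(** The previous vanishing result only reaches interior points. A boundary point is joined to the
    barycenter: on that segment [f] is a univariate polynomial that vanishes for every parameter in
    ]0, 1], hence also at 0. *)
Lemma row_integral_unit_simplex_eq0 n (f : 'rV[R]_n -> R) : polyfun f ->
  (forall x, Delta n x -> 0 <= f x) -> row_integral (Delta n) f = 0 ->
  forall x, Delta n x -> f x = 0.
Proof.
move=> pf f0 If x [x0 x1].
pose b : 'rV[R]_n := const_mx n.+1%:R^-1.
have [q qf] := polyfun_line x (b - x) pf.
have qs s : 0 < s -> s <= 1 -> q.[s] = 0.
  move=> s0 s1; rewrite -qf; apply: (row_integral_eq0 _ _ pf f0 If) => //.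
  (* With [k] the inverse of [n.+1], the point at parameter [s] has coordinates at least [s * k] and
     coordinate sum at most [1 - s * k]. The radius [s * k * k] is below [s * k], and so is [n]
     times this radius. *)
  pose e := s / n.+1%:R ^+ 2.
  have N0 : 0 < n.+1%:R :> R by rewrite ltr0n.
  apply/nbhs_ballP; exists e => /=; first by rewrite divr_gt0 ?exprn_gt0.
  move=> y xy.
  have yi i : `|(x + s *: (b - x)) 0 i - y 0 i| < e by exact: (xy.2 0 i).
  pose k := n.+1%:R^-1 : R; have k0 : 0 < k by rewrite invr_gt0.
  have nk : n%:R * k = 1 - k.
    have : (n%:R + 1) * k = 1 by rewrite natr1 /k mulfV// gt_eqF.
    by rewrite mulrDl mul1r => nk1; apply/eqP; rewrite eq_sym subr_eq nk1.
  have eE : e = s * k * k by rewrite /e -exprVn expr2 mulrA.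
  have pi i : (x + s *: (b - x)) 0 i = (1 - s) * x 0 i + s * k.
    by rewrite !mxE -/k; ring.
  have e1 : e <= s * k by rewrite eE ler_piMr ?mulr_ge0 ?(ltW k0) ?(ltW s0)// invf_le1// ler1n.
  have s1x i : 0 <= (1 - s) * x 0 i by rewrite mulr_ge0// subr_ge0.
  split => [i|].
    by have := yi i; have := s1x i; rewrite pi ltr_norml; lra.
  apply: (@le_trans _ _ (\sum_i ((1 - s) * x 0 i + (s * k + e)))).
    by apply: ler_sum => i _; have := yi i; rewrite pi ltr_norml; lra.
  rewrite big_split /= -mulr_sumr sumr_const card_ord -mulr_natl.
  have -> : n%:R * (s * k + e) = s - s * k * k.
    have -> : n%:R * (s * k + e) = (n%:R * k) * (s + s * k) by rewrite eE; ring.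
    by rewrite nk; ring.
  have : (1 - s) * \sum_i x 0 i <= (1 - s) * 1 by rewrite ler_wpM2l// subr_ge0.
  have : 0 <= s * k * k by rewrite !mulr_ge0// ltW.
  lra.
suff q0 : q = 0 by have := qf 0; rewrite q0 horner0 scale0r addr0.
(* The inverses of 1, ..., [size q] are distinct roots in ]0, 1], too many for a nonzero [q]. *)
apply: (@roots_geq_poly_eq0 _ _ [seq k.+1%:R^-1 | k <- iota 0 (size q)]).
- apply/allP => _ /mapP[k _ ->]; apply/eqP/qs; first by rewrite invr_gt0 ltr0n.
  by rewrite invf_le1 ?ltr0n// ler1n.
- rewrite map_inj_uniq ?iota_uniq// => i j /invr_inj /eqP.
  by rewrite eqr_nat => /eqP[].
- by rewrite size_map size_iota.
Qed.

End reference_simplex.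

(** * Complex polynomials and their values at real points *)

Section complex_polynomial_functions.
Context (R : realType).
Local Notation C := (R[i]).

Lemma Re_mul (x y : C) : Re (x * y) = Re x * Re y - Im x * Im y.
Proof. by case: x y => [a b] [c d]. Qed.

Lemma Im_mul (x y : C) : Im (x * y) = Re x * Im y + Im x * Re y.
Proof. by case: x y => [a b] [c d]. Qed.

Lemma Re_add (x y : C) : Re (x + y) = Re x + Re y.
Proof. by case: x y => [a b] [c d]. Qed.

Lemma Im_add (x y : C) : Im (x + y) = Im x + Im y.
Proof. by case: x y => [a b] [c d]. Qed.

Lemma complex_ext (x y : C) : Re x = Re y -> Im x = Im y -> x = y.
Proof. by case: x y => [a b] [c d] /= -> ->. Qed.

Definition cpolyfun n (f : 'rV[R]_n -> C) :=
  polyfun (fun x => Re (f x)) /\ polyfun (fun x => Im (f x)).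

Lemma cpolyfun_cst n (c : C) : cpolyfun (fun _ : 'rV[R]_n => c).
Proof. by split; exact: polyfun_cst. Qed.

Lemma cpolyfunD n (f g : 'rV[R]_n -> C) : cpolyfun f -> cpolyfun g ->
  cpolyfun (fun x => f x + g x).
Proof.
move=> [fr fi] [gr gi]; split.
  by under eq_fun do rewrite Re_add; exact: polyfunD.
by under eq_fun do rewrite Im_add; exact: polyfunD.
Qed.

Lemma cpolyfunM n (f g : 'rV[R]_n -> C) : cpolyfun f -> cpolyfun g ->
  cpolyfun (fun x => f x * g x).
Proof.
move=> [fr fi] [gr gi]; split.
  by under eq_fun do rewrite Re_mul; apply: polyfunB; exact: polyfunM.
by under eq_fun do rewrite Im_mul; apply: polyfunD; exact: polyfunM.
Qed.

Lemma cpolyfun_affine m n (a : 'rV[R]_n) (A : 'M[R]_(m, n)) (f : 'rV[R]_n -> C) :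
  cpolyfun f -> cpolyfun (fun x => f (a + x *m A)).
Proof.
by move=> [fr fi]; split; [exact: (polyfun_affine a A fr)|exact: (polyfun_affine a A fi)].
Qed.

(** Evaluation, conjugation and restriction to lines are compatible with products, which makes ring
    generators more convenient than monomials. *)
Lemma mpoly_ind_ring n (S : nzRingType) (K : mpoly n S -> Prop) :
  (forall c, K (mpolyC n c)) -> (forall i, K (mpolyX S (mnm1 i))) ->
  (forall p q, K p -> K q -> K (p + q)) -> (forall p q, K p -> K q -> K (p * q)) ->
  forall p, K p.
Proof.
move=> KC KX KD KM; elim/mpolyind => [|c m p _ _ Kp].
  by rewrite -(mpolyC0 n S).
apply: KD => //; rewrite -mul_mpolyC; apply: (KM) => //.
rewrite mpolyXE_id; apply: (big_ind K) => [||i _]; [by rewrite -(mpolyC1 n S)|exact: KM|].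
elim: (m i) => [|k IHk]; first by rewrite expr0 -(mpolyC1 n S).
by rewrite exprS; exact: KM.
Qed.

Lemma peval_cst n c (x : 'rV[R]_n) : peval (mpolyC n c) x = c.
Proof. exact: mevalC. Qed.

Lemma peval_var n (i : 'I_n) (x : 'rV[R]_n) : peval (mpolyX C (mnm1 i)) x = (x 0 i)%:C.
Proof. exact: mevalXU. Qed.

Lemma pevalD n (p q : mpoly n C) x : peval (p + q) x = peval p x + peval q x.
Proof. exact: mevalD. Qed.

Lemma pevalM n (p q : mpoly n C) x : peval (p * q) x = peval p x * peval q x.
Proof. exact: mevalM. Qed.

Lemma pevalZ n c (p : mpoly n C) x : peval (c *: p) x = c * peval p x.
Proof. exact: mevalZ. Qed.

Lemma peval_sum n (I : Type) (r : seq I) (P : pred I) (F : I -> mpoly n C) x :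
  peval (\sum_(i <- r | P i) F i) x = \sum_(i <- r | P i) peval (F i) x.
Proof.
elim: r => [|i r IHr]; first by rewrite !big_nil; exact: meval0.
by rewrite !big_cons; case: ifP => // _; rewrite pevalD IHr.
Qed.

Lemma cpolyfun_peval n (p : mpoly n C) : cpolyfun (peval p).
Proof.
elim/mpoly_ind_ring: p => [c|i|p q pp pq|p q pp pq].
- by rewrite (funext (peval_cst c)); exact: cpolyfun_cst.
- rewrite (funext (peval_var i)); split; first exact: polyfun_coord.
  exact: polyfun_cst.
- by rewrite (funext (pevalD p q)); exact: cpolyfunD.
- by rewrite (funext (pevalM p q)); exact: cpolyfunM.
Qed.

(** At real points this polynomial takes the conjugate values, so that integrands of sesquilinear
    forms remain polynomials. *)
Definition mconj n (p : mpoly n C) : mpoly n C := map_mpoly (@conjc R) p.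

Lemma mconjD n (p q : mpoly n C) : mconj (p + q) = mconj p + mconj q.
Proof. exact: rmorphD. Qed.

Lemma mconjM n (p q : mpoly n C) : mconj (p * q) = mconj p * mconj q.
Proof. exact: rmorphM. Qed.

Lemma conjcD (x y : C) : conjc (x + y) = conjc x + conjc y.
Proof. exact: rmorphD. Qed.

Lemma conjcM (x y : C) : conjc (x * y) = conjc x * conjc y.
Proof. exact: rmorphM. Qed.

Lemma peval_conj n (p : mpoly n C) x : peval (mconj p) x = conjc (peval p x).
Proof.
elim/mpoly_ind_ring: p => [c|i|p q pp pq|p q pp pq].
- by rewrite /mconj map_mpolyC ?conjc0// !peval_cst.
- by rewrite /mconj map_mpolyX !peval_var conjc_real.
- rewrite mconjD pevalD [in RHS]pevalD conjcD.
  by apply: (f_equal2 (fun y z : C => y + z)).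
- rewrite mconjM pevalM [in RHS]pevalM conjcM.
  by apply: (f_equal2 (fun y z : C => y * z)).
Qed.

Lemma mderiv_conj n i (p : mpoly n C) : mderiv i (mconj p) = mconj (mderiv i p).
Proof.
apply/mpolyP => m.
by rewrite mcoeff_mderiv !mcoeff_map_mpoly mcoeff_mderiv raddfMn.
Qed.

Definition mderiv_along n (e : 'rV[R]_n) (p : mpoly n C) : mpoly n C :=
  \sum_i (e 0 i)%:C *: mderiv i p.

Lemma mderiv_alongD n e (p q : mpoly n C) :
  mderiv_along e (p + q) = mderiv_along e p + mderiv_along e q.
Proof. by rewrite -big_split; apply: eq_bigr => i _; rewrite /= mderivD scalerDr. Qed.

Lemma mderiv_alongM n e (p q : mpoly n C) :
  mderiv_along e (p * q) = mderiv_along e p * q + p * mderiv_along e q.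
Proof.
rewrite /mderiv_along mulr_suml mulr_sumr -big_split; apply: eq_bigr => i _ /=.
by rewrite mderivM scalerDr scalerAl scalerAr.
Qed.

(** Directional derivatives are matched with formal derivatives of univariate real polynomials, one
    for each of the real and imaginary parts. This is the form in which the fundamental theorem of
    calculus can be applied. *)
Lemma peval_line n (p : mpoly n C) (x e : 'rV[R]_n) : exists q r : {poly R}, forall s,
  peval p (x + s *: e) = q.[s] +i* r.[s] /\
  peval (mderiv_along e p) (x + s *: e) = q^`().[s] +i* r^`().[s].
Proof.
elim/mpoly_ind_ring: p => [[a b]|i|p1 p2 [q1 [r1 H1]] [q2 [r2 H2]]|p1 p2 [q1 [r1 H1]] [q2 [r2 H2]]].
- exists a%:P, b%:P => s; rewrite peval_cst !hornerE; split=> //.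
  rewrite /mderiv_along big1 ?(meval0)//; first by rewrite !poly.derivE !hornerE /peval meval0.
  by move=> i _; rewrite mderivC scaler0.
- exists ((x 0 i)%:P + 'X * (e 0 i)%:P), 0 => s; rewrite peval_var !hornerE !mxE; split=> //.
  rewrite /mderiv_along (bigD1 i)//= big1 ?addr0.
    rewrite mderivX mnm1E eqxx.
    have -> : mnm_sub (mnm1 i) (mnm1 i) = mnm0 by apply/mnmP => j; rewrite mnmBE subnn mnm0E.
    by rewrite mpolyX0 scale1r pevalZ /peval meval1 mulr1 !poly.derivE !hornerE.
  by move=> j ji; rewrite mderivX mnm1E eq_sym (negbTE ji) scale0r scaler0.
- exists (q1 + q2), (r1 + r2) => s; have [e1 d1] := H1 s; have [e2 d2] := H2 s.
  by rewrite pevalD mderiv_alongD pevalD !poly.derivE e1 e2 d1 d2 !hornerE.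
- exists (q1 * q2 - r1 * r2), (q1 * r2 + r1 * q2) => s; have [e1 d1] := H1 s; have [e2 d2] := H2 s.
  rewrite pevalM mderiv_alongM pevalD !pevalM !poly.derivE e1 e2 d1 d2 !hornerE; split=> //.
  by apply: complex_ext; rewrite /= ?Re_add ?Im_add ?Re_mul ?Im_mul /=; ring.
Qed.

Lemma CintegralE n D (f : 'rV[R]_n -> C) :
  Cintegral D f = row_integral D (fun x => Re (f x)) +i* row_integral D (fun x => Im (f x)).
Proof. by []. Qed.

Lemma eq_Cintegral n D (f g : 'rV[R]_n -> C) : (forall x, D x -> f x = g x) ->
  Cintegral D f = Cintegral D g.
Proof. by move=> fg; rewrite !CintegralE; congr (_ +i* _); apply: eq_row_integral => x /fg ->. Qed.

Section linearity.
Variables (n : nat) (D : set 'rV[R]_n).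
Hypotheses (mD : row_measurable D) (bD : row_bounded D).

Lemma CintegralD f g : cpolyfun f -> cpolyfun g ->
  Cintegral D (fun x => f x + g x) = Cintegral D f + Cintegral D g.
Proof.
move=> [fr fi] [gr gi]; rewrite !CintegralE; apply: complex_ext => /=.
  by rewrite -row_integralD//; apply: eq_row_integral => x _; rewrite Re_add.
by rewrite -row_integralD//; apply: eq_row_integral => x _; rewrite Im_add.
Qed.

Lemma CintegralZ c f : cpolyfun f -> Cintegral D (fun x => c * f x) = c * Cintegral D f.
Proof.
move=> [fr fi]; rewrite !CintegralE; apply: complex_ext; rewrite ?Re_mul ?Im_mul /=.
  rewrite -mulNr -!row_integralZ// -row_integralD//;
    try by apply: polyfunM => //; exact: polyfun_cst.
  by apply: eq_row_integral => x _; rewrite Re_mul mulNr.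
rewrite -!row_integralZ// -row_integralD//; try by apply: polyfunM => //; exact: polyfun_cst.
by apply: eq_row_integral => x _; rewrite Im_mul.
Qed.

Lemma Cintegral_conj f : cpolyfun f ->
  Cintegral D (fun x => conjc (f x)) = conjc (Cintegral D f).
Proof.
move=> [fr fi]; rewrite !CintegralE; apply: complex_ext => /=.
  by apply: eq_row_integral => x _; case: (f x).
by rewrite -mulN1r -row_integralZ//; apply: eq_row_integral => x _; rewrite mulN1r; case: (f x).
Qed.

End linearity.

Lemma Cintegral_affine n (A : 'M[R]_n) (b : 'rV[R]_n) D f : A \in unitmx ->
  row_measurable D -> row_bounded D -> cpolyfun f ->
  Cintegral ((fun x => b + x *m A) @` D) f =
  `|\det A|%:C * Cintegral D (fun x => f (b + x *m A)).
Proof.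
move=> uA mD bD [fr fi]; rewrite !CintegralE; apply: complex_ext.
  by rewrite Re_mul /= mul0r subr0 row_integral_affine.
by rewrite Im_mul /= mul0r addr0 row_integral_affine.
Qed.

End complex_polynomial_functions.

(** * Simplices *)

Section simplices.
Context (R : realType) (d : nat).
Local Notation C := (R[i]).
Local Notation point := 'rV[R]_d.
Local Notation Delta n := (@unit_simplex R n).

(** The number [k] of edges is kept apart from the dimension: elements use [k = d], faces one less,
    where this unfolds to [face_mx]. *)
Definition edge_mx k (S : seq point) : 'M[R]_(k, d) :=
  \matrix_(i, j) (S`_i.+1 - S`_0) 0 j.

Definition simplex_map k (S : seq point) (t : 'rV[R]_k) : point :=
  S`_0 + t *m edge_mx k S.

(** Barycentric coordinates, the origin of the unit simplex coming first. *)
Definition bary k (t : 'rV[R]_k) : 'rV[R]_k.+1 := row_cons (1 - \sum_i t 0 i) t.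

Lemma sum_row_cons k s (t : 'rV[R]_k) : \sum_i row_cons s t 0 i = s + \sum_i t 0 i.
Proof.
rewrite big_ord_recl row_cons0; congr (_ + _).
by apply: eq_bigr => i _; rewrite row_consS.
Qed.

Lemma sum_bary k (t : 'rV[R]_k) : \sum_i bary t 0 i = 1.
Proof. by rewrite sum_row_cons subrK. Qed.

Lemma bary_ge0 k (t : 'rV[R]_k) : Delta k t <-> forall i, 0 <= bary t 0 i.
Proof.
split=> [[t0 t1] i|t0].
  by case: (unliftP ord0 i) => [j ->|->]; rewrite ?row_consS ?row_cons0 ?subr_ge0.
split=> [i|]; first by have := t0 (lift ord0 i); rewrite row_consS.
by have := t0 ord0; rewrite row_cons0 subr_ge0.
Qed.

Lemma row_edge_mx k (S : seq point) i : row i (edge_mx k S) = S`_i.+1 - S`_0.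
Proof. by apply/rowP => j; rewrite mxE mxE. Qed.

Lemma simplex_mapE k (S : seq point) (t : 'rV[R]_k) :
  simplex_map S t = \sum_i bary t 0 i *: S`_i.
Proof.
rewrite big_ord_recl row_cons0 /simplex_map mulmx_sum_row.
rewrite (eq_bigr (fun i => t 0 i *: S`_i.+1 - t 0 i *: S`_0)); last first.
  by move=> i _; rewrite row_edge_mx scalerBr.
rewrite big_split /= sumrN -scaler_suml scalerBl scale1r.
rewrite addrA [RHS]addrAC; congr (_ + _ - _).
by apply: eq_bigr => i _; rewrite row_consS.
Qed.

Lemma simplex_map_affine k (S : seq point) n (w : 'I_n -> R) (x : 'I_n -> 'rV[R]_k) :
  \sum_i w i = 1 ->
  simplex_map S (\sum_i w i *: x i) = \sum_i w i *: simplex_map S (x i).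
Proof.
move=> w1; rewrite /simplex_map -[S`_0 in LHS]scale1r -w1 scaler_suml mulmx_suml.
by rewrite -big_split; apply: eq_bigr => i _; rewrite scalerDr scalemxAl.
Qed.

End simplices.

Section enumerated_simplices.
Context (R : realType) (V : finType).
Local Notation C := (R[i]).
Local Notation Delta n := (@unit_simplex R n).
Implicit Types (K F : {set V}) (s : seq V).

Lemma size_mem s k : size s = k.+1 -> exists v, v \in s.
Proof. by case: s => // v s _; exists v; exact: mem_head. Qed.

Definition enumerates K s := uniq s /\ K =i s.

Lemma enumerates_size K s : enumerates K s -> size s = #|K|.
Proof. by move=> [us Ks]; rewrite (eq_card Ks); apply/esym/card_uniqP. Qed.

Lemma enumerates_enum K : enumerates K (enum K).
Proof. by split; [exact: enum_uniq|move=> x; rewrite mem_enum]. Qed.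

Lemma sum_enumerates (M : zmodType) (v0 : V) K s k (H : V -> M) : enumerates K s ->
  size s = k.+1 -> \sum_(v in K) H v = \sum_(i < k.+1) H (nth v0 s i).
Proof.
move=> [us Ks] sk; rewrite (eq_bigl (mem s)) //.
by rewrite -big_uniq//= (big_nth v0) sk big_mkord.
Qed.

(** A vector in the left kernel, completed at the base vertex by minus the sum of its entries, is an
    affine relation between the vertices. *)
Lemma edge_mx_row_free d (vtx : V -> 'rV[R]_d) K s k : enumerates K s ->
  size s = k.+1 -> aff_independent vtx K -> row_free (edge_mx k (map vtx s)).
Proof.
move=> Ks sk ind; have [us Ksi] := Ks.
rewrite -kermx_eq0; apply/eqP/row_matrixP => r; rewrite row0.
set u := row r _; have : u *m edge_mx k (map vtx s) = 0.
  by apply/sub_kermxP; exact: row_sub.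
move: u => {r} u u0.
have [v0 _] := size_mem sk.
have size_lt (i : 'I_k.+1) : (i < size s)%N by rewrite sk.
pose e := row_cons (- \sum_i u 0 i) u.
(* Coefficients are indexed by position in [s] and must be turned into a function on [V]; the
   default 0 is never reached on [K]. *)
pose c v := if insub (index v s) is Some i then e 0 i else 0.
have cE (i : 'I_k.+1) : c (nth v0 s i) = e 0 i.
  by rewrite /c index_uniq// valK.
apply/rowP => i; rewrite mxE -(row_consS (- \sum_i u 0 i)) -/e -cE.
apply: ind; last by rewrite Ksi mem_nth.
  rewrite (sum_enumerates v0 _ Ks sk) -[RHS](addNr (\sum_i u 0 i)) -sum_row_cons.
  by apply: eq_bigr => j _; exact: cE.
rewrite (sum_enumerates v0 _ Ks sk) big_ord_recl cE row_cons0.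
rewrite -[RHS]u0 mulmx_sum_row.
rewrite [RHS](eq_bigr (fun i => u 0 i *: (map vtx s)`_i.+1 - u 0 i *: (map vtx s)`_0)); last first.
  by move=> j _; rewrite row_edge_mx scalerBr.
rewrite [RHS]big_split /= sumrN -scaler_suml [RHS]addrC scaleNr; congr (- (_ *: _) + _).
  by rewrite (nth_map v0)//; exact: (size_lt ord0).
apply: eq_bigr => j _; rewrite (cE (lift ord0 j)) row_consS; congr (_ *: _).
by rewrite (nth_map v0)//; exact: (size_lt (lift ord0 j)).
Qed.

Lemma hull_simplex_map d (vtx : V -> 'rV[R]_d) K s k : enumerates K s ->
  size s = k.+1 -> hull vtx K = simplex_map (map vtx s) @` Delta k.
Proof.
move=> Ks sk; have [us Ksi] := Ks.
have [v0 _] := size_mem sk.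
have size_lt (i : 'I_k.+1) : (i < size s)%N by rewrite sk.
apply/seteqP; split => x.
  move=> [w [w0 w1 ->]]; pose t := \row_(i < k) w (nth v0 s i.+1).
  have tE i : bary t 0 i = w (nth v0 s i).
    case: (unliftP ord0 i) => [j ->|->]; first by rewrite row_consS mxE.
    rewrite row_cons0 -w1 (sum_enumerates v0 _ Ks sk) big_ord_recl /=.
    rewrite (eq_bigr (fun i => t 0 i)) ?addrK// => j _.
    by rewrite mxE.
  exists t; first by apply/bary_ge0 => i; rewrite tE w0// Ksi mem_nth.
  rewrite simplex_mapE (sum_enumerates v0 _ Ks sk); apply: eq_bigr => i _.
  by rewrite tE (nth_map v0).
move=> [t /bary_ge0 t0 <-].
pose w v := if insub (index v s) is Some i then bary t 0 i else 0.
have wE (i : 'I_k.+1) : w (nth v0 s i) = bary t 0 i.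
  by rewrite /w index_uniq// valK.
exists w; split.
- by move=> v _; rewrite /w; case: insubP.
- rewrite (sum_enumerates v0 _ Ks sk) -[RHS](sum_bary t).
  by apply: eq_bigr => i _; exact: wE.
- rewrite simplex_mapE (sum_enumerates v0 _ Ks sk); apply: eq_bigr => i _.
  by rewrite wE (nth_map v0).
Qed.

(* the vertex of the unit simplex at the position of v in s *)
Definition ref_vertex k s (v : V) : 'rV[R]_k := \row_i (index v s == i.+1)%:R.

Lemma bary_ref_vertex k s v i : v \in s -> size s = k.+1 ->
  bary (ref_vertex k s v) 0 i = (index v s == i)%:R.
Proof.
move=> vs sk; case: (unliftP ord0 i) => [j ->|->]; first by rewrite row_consS mxE.
rewrite row_cons0; under eq_bigr do rewrite mxE.
have : (index v s < k.+1)%N by rewrite -sk index_mem.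
case: (index v s) => [|m] mk.
  by rewrite big1 ?subr0// => j _.
rewrite (bigD1 (Ordinal (mk : (m < k)%N)))//= eqxx big1 ?addr0 ?subrr// => j jm.
by rewrite eqSS; case: eqP => // mj; case/eqP: jm; exact/val_inj.
Qed.

Lemma simplex_map_ref_vertex d (vtx : V -> 'rV[R]_d) k s v : v \in s -> size s = k.+1 ->
  simplex_map (map vtx s) (ref_vertex k s v) = vtx v.
Proof.
move=> vs sk; rewrite simplex_mapE.
have vk : (index v s < k.+1)%N by rewrite -sk index_mem.
rewrite (bigD1 (Ordinal vk))//= bary_ref_vertex// eqxx scale1r big1 ?addr0.
  by rewrite (nth_map v) ?index_mem// nth_index.
move=> j jv; rewrite bary_ref_vertex//; case: eqP => [vj|]; last by rewrite scale0r.
by case/eqP: jv; exact/val_inj.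
Qed.

(** Changing the enumeration amounts to composing with an affine map of the reference simplex, since
    affine maps are determined by the images of the vertices. *)
Lemma simplex_map_comp d (vtx : V -> 'rV[R]_d) k s s' (t : 'rV[R]_k) :
  {subset s' <= s} -> size s = k.+1 -> size s' = k.+1 ->
  simplex_map (map vtx s) (simplex_map (map (ref_vertex k s) s') t) =
  simplex_map (map vtx s') t.
Proof.
move=> s's sk s'k.
have [v0 _] := size_mem sk.
rewrite [simplex_map (map (ref_vertex _ _) _) t]simplex_mapE.
rewrite simplex_map_affine ?sum_bary// [RHS]simplex_mapE.
have size_lt (i : 'I_k.+1) : (i < size s')%N by rewrite s'k.
apply: eq_bigr => i _; rewrite !(nth_map v0)//.
by rewrite simplex_map_ref_vertex//; apply: s's; rewrite mem_nth.
Qed.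

Lemma simplex_map_ref_id k s (t : 'rV[R]_k) : uniq s -> size s = k.+1 ->
  simplex_map (map (ref_vertex k s) s) t = t.
Proof.
move=> us sk; have [v0 _] := size_mem sk.
have size_lt (i : 'I_k.+1) : (i < size s)%N by rewrite sk.
rewrite simplex_mapE big_ord_recl /= (nth_map v0)//; last exact: (size_lt ord0).
apply/rowP => j; rewrite mxE summxE !mxE (index_uniq _ (size_lt ord0))// mulr0 add0r.
rewrite (bigD1 j)//= big1 ?addr0.
  rewrite row_consS mxE (nth_map v0) ?mxE ?index_uniq ?eqxx ?mulr1//;
  exact: (size_lt (lift ord0 j)).
move=> i ij; rewrite mxE (nth_map v0) ?mxE; last exact: (size_lt (lift ord0 i)).
rewrite index_uniq//; last exact: (size_lt (lift ord0 i)).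
by rewrite eqSS; case: eqP => [ji|]; [case/eqP: ij; exact/val_inj|rewrite mulr0].
Qed.

End enumerated_simplices.

(** * The divergence theorem on a simplex *)

Section integration_on_simplices.
Context (R : realType) (V : finType).
Local Notation C := (R[i]).
Local Notation Delta n := (@unit_simplex R n).
Implicit Types (K F : {set V}) (s : seq V).

Hint Resolve row_measurable_unit_simplex row_bounded_unit_simplex : core.

(** Reordering back is an inverse affine map, so the linear parts are inverse to each other. *)
Lemma ref_reorder_unit k K s s' : enumerates K s -> enumerates K s' -> size s = k.+1 ->
  edge_mx k (map (@ref_vertex R V k s) s') \in unitmx.
Proof.
move=> Ks Ks' sk; have [us Ksi] := Ks; have [us' Ksi'] := Ks'.
have s'k : size s' = k.+1 by rewrite (enumerates_size Ks') -(enumerates_size Ks).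
pose A := edge_mx k (map (@ref_vertex R V k s) s').
pose A' := edge_mx k (map (@ref_vertex R V k s') s).
pose a := (map (@ref_vertex R V k s) s')`_0.
pose a' := (map (@ref_vertex R V k s') s)`_0.
have AA' t : a' + (a + t *m A) *m A' = t.
  rewrite -[RHS](simplex_map_ref_id (R := R) t us' s'k).
  rewrite -(@simplex_map_comp _ _ _ (@ref_vertex R V k s') _ s)//.
  by move=> v; rewrite -Ksi -Ksi'.
have := AA' 0; rewrite mul0mx addr0 => a0.
suff /mulmx1_unit[] : A *m A' = 1%:M by [].
apply/row_matrixP => i; rewrite !rowE mulmx1 mulmxA.
have := AA' (delta_mx 0 i); rewrite mulmxDl addrA a0 add0r.
by [].
Qed.

Lemma ref_reorder_simplex k K s s' : enumerates K s -> enumerates K s' -> size s = k.+1 ->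
  Delta k = (fun x => (map (@ref_vertex R V k s) s')`_0 +
    x *m edge_mx k (map (@ref_vertex R V k s) s')) @` Delta k.
Proof.
move=> Ks Ks' sk; have [us _] := Ks.
have s'k : size s' = k.+1 by rewrite (enumerates_size Ks') -(enumerates_size Ks).
rewrite -[RHS](hull_simplex_map _ Ks' s'k) (hull_simplex_map _ Ks sk).
apply/seteqP; split => [x Dx|_ [x Dx <-]].
  by exists x => //; exact: simplex_map_ref_id.
by rewrite simplex_map_ref_id.
Qed.

(** The reordering maps the unit simplex onto itself, so the change of variables for the constant 1
    reads [vol = |det| vol], and the volume is not zero. *)
Lemma ref_reorder_det k K s s' : enumerates K s -> enumerates K s' -> size s = k.+1 ->
  `|\det (edge_mx k (map (@ref_vertex R V k s) s'))| = 1.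
Proof.
move=> Ks Ks' sk; have [us Ksi] := Ks.
have s'k : size s' = k.+1 by rewrite (enumerates_size Ks') -(enumerates_size Ks).
have uA := ref_reorder_unit Ks Ks' sk.
pose one (x : 'rV[R]_k) : R := 1.
have one_poly : polyfun one by exact: polyfun_cst.
have vol_neq0 : row_integral (Delta k) one != 0.
  apply/eqP => vol0.
  have := row_integral_unit_simplex_eq0 one_poly _ vol0 (x := 0) => one0.
  have /eqP : one 0 = 0.
    apply: one0 => [x _|]; first exact: ler01.
    split=> [i|]; first by rewrite mxE.
    by rewrite big1 ?ler01// => i _; rewrite mxE.
  by rewrite oner_eq0.
have DE := ref_reorder_simplex Ks Ks' sk.
have := row_integral_affine ((map (@ref_vertex R V k s) s')`_0) uA
  (@row_measurable_unit_simplex R k) (@row_bounded_unit_simplex R k) one_poly.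
rewrite -DE -{1}[row_integral _ _]mul1r => /(mulIf vol_neq0) <-.
by [].
Qed.

(** Frees face integrals from the order imposed by [enum]. *)
Lemma Cintegral_reorder d (vtx : V -> 'rV[R]_d) k K s s' (f : 'rV[R]_d -> C) :
  enumerates K s -> enumerates K s' -> size s = k.+1 -> cpolyfun f ->
  Cintegral (Delta k) (f \o simplex_map (map vtx s)) =
  Cintegral (Delta k) (f \o simplex_map (map vtx s')).
Proof.
move=> Ks Ks' sk pf; have [us Ksi] := Ks; have [us' Ksi'] := Ks'.
have s'k : size s' = k.+1 by rewrite (enumerates_size Ks') -(enumerates_size Ks).
have uA := ref_reorder_unit Ks Ks' sk.
have DE := ref_reorder_simplex Ks Ks' sk.
rewrite {1}DE Cintegral_affine//; last exact: cpolyfun_affine.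
rewrite (ref_reorder_det Ks Ks' sk) mul1r.
apply: eq_Cintegral => t _; rewrite /= -/(simplex_map _ t) simplex_map_comp//.
by move=> v; rewrite -Ksi -Ksi'.
Qed.

Section element.
Context (n : nat) (vtx : V -> 'rV[R]_n.+1) (K : {set V}).
Hypotheses (cardK : #|K| = n.+2) (indK : aff_independent vtx K).
Local Notation point := 'rV[R]_n.+1.
Local Notation poly := (mpoly n.+1 C).

Let mxK s := edge_mx n.+1 (map vtx s).

Lemma edge_mx_unit s : enumerates K s -> mxK s \in unitmx.
Proof.
move=> Ks; rewrite -row_free_unit; apply: (edge_mx_row_free Ks _ indK).
by rewrite (enumerates_size Ks).
Qed.

Lemma Cintegral_hull s f : enumerates K s -> cpolyfun f ->
  Cintegral (hull vtx K) f =
  `|\det (mxK s)|%:C * Cintegral (Delta n.+1) (f \o simplex_map (map vtx s)).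
Proof.
move=> Ks pf; have sk : size s = n.+2 by rewrite (enumerates_size Ks).
by rewrite (hull_simplex_map _ Ks sk) Cintegral_affine//; exact: edge_mx_unit.
Qed.

Lemma row_measurable_hull : row_measurable (hull vtx K).
Proof.
have Ks := enumerates_enum K; have sk := enumerates_size Ks; rewrite cardK in sk.
by rewrite (hull_simplex_map _ Ks sk); apply: row_measurable_affine => //; exact: edge_mx_unit.
Qed.

Lemma row_bounded_hull : row_bounded (hull vtx K).
Proof.
have Ks := enumerates_enum K; have sk := enumerates_size Ks; rewrite cardK in sk.
by rewrite (hull_simplex_map _ Ks sk); exact: row_bounded_affine.
Qed.

Lemma abs_det_edge_mx s s' : enumerates K s -> enumerates K s' ->
  `|\det (mxK s)| = `|\det (mxK s')|.
Proof.
move=> Ks Ks'; have sk := enumerates_size Ks; rewrite cardK in sk.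
have s'k := enumerates_size Ks'; rewrite cardK in s'k.
have -> : mxK s' = edge_mx n.+1 (map (@ref_vertex R V n.+1 s) s') *m mxK s.
  have s's : {subset s' <= s} by move=> v; rewrite -(proj2 Ks) -(proj2 Ks').
  have E t := simplex_map_comp vtx t s's sk s'k.
  apply/row_matrixP => i; rewrite !rowE mulmxA.
  have := E (delta_mx 0 i); have := E 0.
  rewrite /simplex_map !mul0mx !addr0 mulmxDl addrA => -> /addrI ->.
  by [].
by rewrite det_mulmx normrM (ref_reorder_det Ks Ks' sk) mul1r.
Qed.

(** The face integral deprived of its surface element. *)
Definition face_mean F (f : point -> C) : C := Cintegral (Delta n) (f \o face_param vtx F).

Lemma face_meanE F s f : enumerates F s -> #|F| = n.+1 -> cpolyfun f ->
  face_mean F f = Cintegral (Delta n) (f \o simplex_map (map vtx s)).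
Proof.
move=> Fs cF pf.
by rewrite -[RHS](Cintegral_reorder _ (enumerates_enum F) Fs)// -cardE.
Qed.

(** Enumerating [K] as [[:: w, v & r]] makes the edge the first coordinate direction. Integrating
    along it leaves the two end values, where the weight of [w] or that of [v] is zero: these are
    the opposite faces. *)
Lemma divergence_edge v w p : v \in K -> w \in K -> v != w ->
  Cintegral (hull vtx K) (peval (mderiv_along (vtx v - vtx w) p)) =
  `|\det (mxK (enum K))|%:C *
    (face_mean (K :\ w) (peval p) - face_mean (K :\ v) (peval p)).
Proof.
move=> vK wK vw; pose r := enum (K :\ v :\ w).
have Er : enumerates (K :\ v :\ w) r by exact: enumerates_enum.
have rE x : x \in r = [&& x != w, x != v & x \in K] by rewrite mem_enum !inE.
have ur : uniq r by exact: enum_uniq.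
have Kwvr : enumerates K [:: w, v & r].
  split; first by rewrite /= !inE !rE !eqxx eq_sym (negbTE vw) ur ?andbF.
  move=> x; rewrite !inE rE.
  by case: (eqVneq x w) => [->|] //=; case: (eqVneq x v) => [->|] //=.
have Kwr : enumerates (K :\ v) (w :: r).
  split; first by rewrite /= !rE !eqxx ur.
  move=> x; rewrite !inE rE.
  by case: (eqVneq x w) => [->|] //=; rewrite eq_sym vw.
have Kvr : enumerates (K :\ w) (v :: r).
  split; first by rewrite /= !rE !eqxx andbF ur.
  move=> x; rewrite !inE rE.
  by case: (eqVneq x v) => [->|] //=; rewrite vw.
have sr : size r = n by have := enumerates_size Kwvr; rewrite cardK => -[].
have cw : #|K :\ w| = n.+1 by rewrite -(enumerates_size Kvr) /= sr.
have cv : #|K :\ v| = n.+1 by rewrite -(enumerates_size Kwr) /= sr.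
have pp := cpolyfun_peval p; have pd := cpolyfun_peval (mderiv_along (vtx v - vtx w) p).
rewrite (face_meanE Kvr cw pp) (face_meanE Kwr cv pp) (Cintegral_hull Kwvr pd).
rewrite (abs_det_edge_mx (enumerates_enum K) Kwvr); congr (_ * _).
set S := map vtx [:: w, v & r].
have lineE t (c : R) : simplex_map S (t + c *: delta_mx 0 0) =
    simplex_map S t + c *: (vtx v - vtx w).
  by rewrite /simplex_map mulmxDl addrA -scalemxAl -rowE row_edge_mx.
have consE t (c : R) : simplex_map S (row_cons c t) =
    vtx w + c *: (vtx v - vtx w) + \sum_(i < n) t 0 i *: (S`_i.+2 - vtx w).
  rewrite /simplex_map mulmx_sum_row big_ord_recl row_cons0 row_edge_mx addrA.
  by congr (_ + _); apply: eq_bigr => i _; rewrite row_consS row_edge_mx.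
have top (t : 'rV[R]_n) : simplex_map S (row_cons (1 - \sum_i t 0 i) t) =
    simplex_map (map vtx (v :: r)) t.
  rewrite consE /simplex_map mulmx_sum_row scalerBl scale1r !addrA.
  rewrite [vtx w + vtx v]addrC addrK -addrA.
  congr (_ + _); rewrite scaler_suml addrC -sumrB; apply: eq_bigr => i _.
  by rewrite row_edge_mx -scalerBr opprB addrA subrK.
have bot (t : 'rV[R]_n) : simplex_map S (row_cons 0 t) = simplex_map (map vtx (w :: r)) t.
  rewrite consE /simplex_map mulmx_sum_row scale0r addr0; congr (_ + _).
  by apply: eq_bigr => i _; rewrite row_edge_mx.
(* [re] stands for the real or the imaginary part, so that one argument serves both. *)
have part (re : C -> R) : polyfun (fun x => re (peval p x)) ->
    polyfun (fun x => re (peval (mderiv_along (vtx v - vtx w) p) x)) ->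
    (forall x e, exists q : {poly R}, forall c, re (peval p (x + c *: e)) = q.[c] /\
      re (peval (mderiv_along e p) (x + c *: e)) = q^`().[c]) ->
    row_integral (Delta n.+1) (fun t => re (peval (mderiv_along (vtx v - vtx w) p) (simplex_map S t))) =
    row_integral (Delta n) (fun t => re (peval p (simplex_map (map vtx (v :: r)) t))) -
    row_integral (Delta n) (fun t => re (peval p (simplex_map (map vtx (w :: r)) t))).
  move=> rp rd line.
  have aff k T (f : point -> R) : polyfun f -> polyfun (fun t : 'rV_k => f (simplex_map T t)).
    exact: polyfun_affine.
  rewrite (@row_integral_unit_simplex_deriv _ _ (fun t => re (peval p (simplex_map S t)))); first last.
  - move=> x; have [q qE] := line (simplex_map S x) (vtx v - vtx w).
    by exists q => c; rewrite lineE.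
  - exact: aff rd.
  - exact: aff rp.
  have pv := aff n (map vtx (v :: r)) _ rp; have pw := aff n (map vtx (w :: r)) _ rp.
  rewrite -[X in _ - X]mul1r -mulNr -row_integralZ// -row_integralD//; last first.
    by apply: polyfunM => //; exact: polyfun_cst.
  by apply: eq_row_integral => t _; rewrite top bot mulN1r.
have [pr pi] := pp; have [dr di] := pd.
rewrite !CintegralE; apply: complex_ext.
  rewrite [LHS](part (@complex.Re R) pr dr) // => x e; have [q [q' E]] := peval_line p x e.
  by exists q => c; have [-> ->] := E c.
rewrite [LHS](part (@complex.Im R) pi di) // => x e; have [q [q' E]] := peval_line p x e.
by exists q' => c; have [-> ->] := E c.
Qed.

End element.
End integration_on_simplices.

(** * Unit normals and surface elements *)

Section dot_product.
Context (R : realType) (d : nat).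
Local Notation point := 'rV[R]_d.

Lemma dotE (x y : point) : dot x y = (x *m y^T) 0 0.
Proof. by rewrite mxE; apply: eq_bigr => i _; rewrite mxE. Qed.

Lemma dotC (x y : point) : dot x y = dot y x.
Proof. by apply: eq_bigr => i _; rewrite mulrC. Qed.

Lemma dotDr (x y z : point) : dot x (y + z) = dot x y + dot x z.
Proof. by rewrite -big_split; apply: eq_bigr => i _; rewrite mxE mulrDr. Qed.

Lemma dotZr (x y : point) c : dot x (c *: y) = c * dot x y.
Proof. by rewrite mulr_sumr; apply: eq_bigr => i _; rewrite mxE mulrCA. Qed.

Lemma dotNr (x y : point) : dot x (- y) = - dot x y.
Proof. by rewrite -scaleN1r dotZr mulN1r. Qed.

Lemma dotBr (x y z : point) : dot x (y - z) = dot x y - dot x z.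
Proof. by rewrite dotDr dotNr. Qed.

Lemma dotZl (x y : point) c : dot (c *: x) y = c * dot x y.
Proof. by rewrite dotC dotZr dotC. Qed.

Lemma dot_gt0 (x : point) : x != 0 -> 0 < dot x x.
Proof.
move=> x0; rewrite lt_neqAle sumr_ge0 ?andbT; last first.
  by move=> i _; rewrite -expr2 sqr_ge0.
apply: contra_neq x0 => /esym /eqP; rewrite psumr_eq0; last first.
  by move=> i _; rewrite -expr2 sqr_ge0.
move=> /allP x0; apply/rowP => i; rewrite mxE.
by have := x0 i (mem_index_enum _); rewrite -expr2 sqrf_eq0 => /eqP.
Qed.

End dot_product.

Section normals.
Context (R : realType) (V : finType) (n : nat) (vtx : V -> 'rV[R]_n.+1) (K : {set V}).
Hypotheses (cardK : #|K| = n.+2) (indK : aff_independent vtx K).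
Local Notation C := (R[i]).
Local Notation point := 'rV[R]_n.+1.

Let mxK s := edge_mx n.+1 (map vtx s).

Variable w : V.
Hypothesis wK : w \in K.

(** The vertex [w] comes second in [s]: the first row of the edge matrix is then the edge from the
    face to [w], and the other rows are exactly [face_mx] of the face opposite [w]. *)
Let f0 := head w (enum (K :\ w)).
Let f' := behead (enum (K :\ w)).
Let s := [:: f0, w & f'].

Let enumF : enum (K :\ w) = f0 :: f'.
Proof.
have := cardsD1 w K; rewrite wK cardK => -[]; rewrite cardE /f0 /f'.
by case: (enum _).
Qed.

Let size_f' : size f' = n.
Proof.
have := cardsD1 w K; rewrite wK cardK => -[]; rewrite cardE enumF /=.
by move=> [].
Qed.

Let f0K : f0 \in K :\ w.
Proof. by rewrite -mem_enum enumF mem_head. Qed.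

Let enum_s : enumerates K s.
Proof.
have uF : uniq (f0 :: f') by rewrite -enumF enum_uniq.
have memF x : (x \in f0 :: f') = (x != w) && (x \in K) by rewrite -enumF mem_enum !inE.
split.
  move: uF; rewrite /s /= !inE => /andP[f0f' ->]; rewrite andbT negb_or f0f'.
  have := memF w; rewrite eqxx inE /= => /negbT; rewrite negb_or => /andP[wf0 ->].
  by rewrite eq_sym wf0.
move=> x; rewrite /s; have := memF x; rewrite !inE.
by case: (eqVneq x w) => [->|xw /= <-]; rewrite ?wK ?orbT.
Qed.

Let M := mxK s.
Let x := vtx w - vtx f0.
Let B := face_mx vtx (K :\ w).

Let ME : M = col_mx x B :> 'M[R]_(1 + n, n.+1).
Proof.
apply/row_matrixP => i; rewrite row_edge_mx.
case: (unliftP ord0 i) => [j ->|->].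
  rewrite (_ : lift ord0 j = rshift 1 j); last exact/val_inj.
  rewrite rowKd -[B]/(edge_mx n (map vtx (enum (K :\ w)))) row_edge_mx enumF.
  by [].
transitivity x => //; rewrite -[LHS](row_id 0) -(rowKu 0 x B).
by congr (row _ _); exact/val_inj.
Qed.

Let uM : M \in unitmx.
Proof. exact: (edge_mx_unit cardK indK enum_s). Qed.

Let face_edges v : v \in K :\ w -> v = f0 \/ exists j, vtx v - vtx f0 = row j B.
Proof.
rewrite -mem_enum enumF inE => /predU1P[->|vf']; [by left|right].
have vn : (index v f' < n)%N by rewrite -size_f' index_mem.
exists (Ordinal vn); rewrite -[B]/(edge_mx n (map vtx (enum (K :\ w)))) row_edge_mx enumF /=.
by rewrite (nth_map v) ?nth_index// index_mem.
Qed.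

(** [xget] needs a witness. Solving a linear system with the edge matrix gives a vector orthogonal
    to the edges of the face and with product -1 with the edge towards [w]; it remains to normalize
    it. *)
Lemma unit_normalP : outward_unit_normal vtx K (K :\ w) (unit_normal vtx K (K :\ w)).
Proof.
apply: xgetPex.
pose y : point := (- invmx M *m delta_mx 0 0)^T.
have My : M *m y^T = - delta_mx 0 0 by rewrite trmxK mulNmx mulmxN mulKVmx.
have xy : dot y x = -1.
  rewrite dotC dotE; have := congr1 (row 0) My; rewrite row_mul row_edge_mx -/x.
  by move=> /rowP/(_ 0) ->; rewrite !mxE !eqxx.
have By j : dot y (row j B) = 0.
  have -> : row j B = row (rshift 1 j) M by rewrite ME rowKd.
  rewrite dotC dotE -row_mul My !mxE.
  by rewrite (_ : _ == 0 = false) ?oppr0.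
have yF v : v \in K :\ w -> dot y (vtx v) = dot y (vtx f0).
  move=> /face_edges[-> //|[j jE]]; apply/eqP; rewrite -subr_eq0 -dotBr.
  by rewrite jE By.
have y0 : y != 0.
  apply/eqP => y0; move: xy; rewrite y0 -[X in dot X _](scale0r 0) dotZl mul0r.
  by move=> /eqP; rewrite eq_sym oppr_eq0 oner_eq0.
have yy := dot_gt0 y0; pose r := (Num.sqrt (dot y y))^-1.
have r0 : 0 < r by rewrite invr_gt0 sqrtr_gt0.
exists (r *: y); split.
- rewrite dotZl dotZr mulrA -expr2 exprVn sqr_sqrtr ?(ltW yy)// mulVf// gt_eqF//.
- by move=> v u vF uF; rewrite dotZl dotBr !yF// subrr mulr0.
- move=> v u vF uK; rewrite !inE uK andbT negbK => /eqP ->.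
  rewrite dotZl dotBr (yF v)// -dotBr -/x xy mulrN1 oppr_lt0//.
Qed.

(** Surface element times height. Replacing the edge [x] by the unit normal multiplies the
    determinant by [a], the inverse of [dot nu x]. The Gram matrix of the new rows is block diagonal
    with blocks 1 and [B *m B^T], so the surface element is the absolute value of the new
    determinant. *)
Lemma face_area v : v \in K :\ w ->
  Num.sqrt (\det (B *m B^T)) * dot (unit_normal vtx K (K :\ w)) (vtx v - vtx w) =
  `|\det (mxK (enum K))|.
Proof.
move=> vF; have [nn nF nw] := unit_normalP; set nu := unit_normal _ _ _ in nn nF nw *.
have wF : w \notin K :\ w by rewrite !inE eqxx.
have xnu : dot nu x < 0 by exact: nw f0K wK wF.
have -> : dot nu (vtx v - vtx w) = - dot nu x.
  by rewrite -(subrK (vtx f0) (vtx v)) -addrA dotDr (nF f0 v)// add0r -dotNr opprB.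
rewrite (abs_det_edge_mx vtx cardK (enumerates_enum K) enum_s) -/M.
pose q := nu *m invmx M; pose a := q 0 0; pose b : 'rV[R]_n := @rsubmx _ _ 1 n q.
have qE : q = row_mx a%:M b by exact: row_mx1_split.
have nuE : nu = a *: x + b *m B.
  rewrite -mul_scalar_mx -mul_row_col -qE -ME /q mulmxKV//.
have Bnu : B *m nu^T = 0.
  apply/colP => j; rewrite mxE [RHS]mxE -[LHS]/(\sum_ _ _).
  have -> : \sum_j0 B j j0 * nu^T j0 0 = dot nu (row j B).
    by apply: eq_bigr => k _; rewrite !mxE mulrC.
  have jF : nth w f' j \in K :\ w.
    by rewrite -mem_enum enumF inE mem_nth ?orbT// size_f'.
  rewrite -[B]/(edge_mx n (map vtx (enum (K :\ w)))) row_edge_mx enumF /=.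
  by rewrite (nth_map w) ?size_f'//; exact: nF.
have ax : a * dot nu x = 1.
  rewrite -[RHS]nn [X in _ = dot _ X]nuE [RHS]dotDr [X in _ = X + _]dotZr.
  by rewrite [X in _ = _ + X]dotC [X in _ = _ + X]dotE -mulmxA Bnu mulmx0 mxE addr0.
pose N : 'M[R]_(1 + n) := col_mx nu B.
have NE : N = block_mx a%:M b 0 1%:M *m (M : 'M[R]_(1 + n)).
  by rewrite ME mul_block_col mul0mx add0r mul1mx mul_scalar_mx -nuE.
have detN : \det N = a * \det M.
  by rewrite NE det_mulmx det_ublock det1 mulr1 det_scalar expr1.
have NN : N *m N^T = block_mx 1%:M 0 0 (B *m B^T).
  rewrite tr_col_mx mul_col_row; congr block_mx => //.
  - by rewrite [LHS]mx11_scalar -dotE nn.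
  - by rewrite -[LHS]trmxK trmx_mul trmxK Bnu trmx0.
have -> : \det (B *m B^T) = (\det N) ^+ 2.
  by rewrite expr2 -{2}(det_tr N) -det_mulmx NN det_ublock det1 mul1r.
rewrite sqrtr_sqr detN normrM -mulrA mulrC -mulrA -(ltr0_norm xnu).
by rewrite -normrM [_ * a]mulrC ax normr1 mulr1.
Qed.

End normals.

(** * From edge directions to all directions *)

Section divergence_theorem.
Context (R : realType) (V : finType) (n : nat) (vtx : V -> 'rV[R]_n.+1) (K : {set V}).
Hypotheses (cardK : #|K| = n.+2) (indK : aff_independent vtx K).
Local Notation C := (R[i]).
Local Notation poly := (mpoly n.+1 C).

Lemma facesP F : reflect (exists2 w, w \in K & F = K :\ w) (F \in faces K).
Proof. exact: imsetP. Qed.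

Lemma sum_faces (M : nmodType) (H : {set V} -> M) :
  \sum_(F in faces K) H F = \sum_(w in K) H (K :\ w).
Proof.
rewrite big_imset// => v w vK wK vw; apply/eqP/negPn/negP => vnw.
have : v \in K :\ v by rewrite vw !inE vnw.
by rewrite !inE eqxx.
Qed.

Lemma mderiv_alongDl e e' (p : poly) :
  mderiv_along (e + e') p = mderiv_along e p + mderiv_along e' p.
Proof.
rewrite -big_split; apply: eq_bigr => i _ /=.
by rewrite mxE rmorphD /= scalerDl.
Qed.

Lemma mderiv_alongZl c e (p : poly) : mderiv_along (c *: e) p = c%:C *: mderiv_along e p.
Proof.
rewrite scaler_sumr; apply: eq_bigr => i _ /=.
by rewrite mxE rmorphM /= scalerA.
Qed.

Lemma mderiv_along_delta i (p : poly) : mderiv_along (delta_mx 0 i) p = mderiv i p.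
Proof.
rewrite /mderiv_along (bigD1 i)//= big1 ?addr0 ?mxE ?eqxx ?scale1r// => j ji.
by rewrite mxE (negbTE ji) scale0r.
Qed.

Let mK := row_measurable_hull cardK indK.
Let bK := row_bounded_hull vtx cardK.

Let flux e p := \sum_(w in K)
  (dot (unit_normal vtx K (K :\ w)) e)%:C * face_integral vtx (K :\ w) (peval p).

Let divergence e p := Cintegral (hull vtx K) (peval (mderiv_along e p)) = flux e p.

Let divergenceD p e e' : divergence e p -> divergence e' p -> divergence (e + e') p.
Proof.
rewrite /divergence => de de'.
rewrite mderiv_alongDl (funext (pevalD _ _)) CintegralD//; try exact: cpolyfun_peval.
rewrite de de' -big_split; apply: eq_bigr => w _ /=.
by rewrite dotDr rmorphD /= mulrDl.
Qed.

Let divergenceZ p c e : divergence e p -> divergence (c *: e) p.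
Proof.
rewrite /divergence => de.
rewrite mderiv_alongZl (funext (pevalZ _ _)) CintegralZ//; try exact: cpolyfun_peval.
rewrite de mulr_sumr; apply: eq_bigr => w _ /=.
by rewrite dotZr rmorphM /= mulrA.
Qed.

(** A face opposite a third vertex contains both [v] and [w], so its normal is orthogonal to the
    edge. On the two remaining faces, [face_area] turns the flux into the determinant times
    [face_mean]. *)
Let divergence_vertices p v w : v \in K -> w \in K -> v != w ->
  divergence (vtx v - vtx w) p.
Proof.
move=> vK wK vw; have wv : w != v by rewrite eq_sym.
have vF : v \in K :\ w by rewrite !inE vw.
have wF : w \in K :\ v by rewrite !inE wv.
rewrite /divergence (divergence_edge cardK indK p vK wK vw) /flux.
have term a b : a \in K -> b \in K -> a != b ->
    (dot (unit_normal vtx K (K :\ a)) (vtx b - vtx a))%:C *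
      face_integral vtx (K :\ a) (peval p) =
    `|\det (edge_mx n.+1 (map vtx (enum K)))|%:C * face_mean vtx (K :\ a) (peval p).
  move=> aK bK' ab; have bF : b \in K :\ a by rewrite !inE eq_sym ab.
  rewrite -(face_area cardK indK aK bF) /face_integral -/(face_mean _ _ _) mulrA.
  by rewrite mulrC [RHS]mulrC -rmorphM; congr (_ * _%:C); exact: mulrC.
rewrite [RHS](bigD1 w wK) [X in _ = _ + X](bigD1 v); last exact/andP.
rewrite [X in _ = _ + (_ + X)]big1; last first.
  move=> x /andP[/andP[xK xw] xv].
  have [_ nF _] := unit_normalP cardK indK xK.
  by rewrite nF ?mul0r// !inE ?wK ?vK eq_sym ?xw ?xv.
have tv : (dot (unit_normal vtx K (K :\ v)) (vtx v - vtx w))%:C *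
      face_integral vtx (K :\ v) (peval p) =
    - (`|\det (edge_mx n.+1 (map vtx (enum K)))|%:C * face_mean vtx (K :\ v) (peval p)).
  by rewrite -opprB dotNr rmorphN mulNr (term v w).
rewrite (term w v wK vK wv) tv.
move: (face_mean _ _ _) (face_mean _ _ _) (_%:C) => A B D; ring.
Qed.

Theorem divergence_theorem i p :
  Cintegral (hull vtx K) (peval (mderiv i p)) =
  \sum_(F in faces K) (unit_normal vtx K F 0 i)%:C * face_integral vtx F (peval p).
Proof.
have Ks := enumerates_enum K; have sk := enumerates_size Ks; rewrite cardK in sk.
have uM := edge_mx_unit cardK indK Ks; set M := edge_mx _ _ in uM.
suff : divergence (delta_mx 0 i) p.
  rewrite /divergence mderiv_along_delta => ->; rewrite sum_faces.
  apply: eq_bigr => w _; congr (_%:C * _).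
  rewrite /dot (bigD1 i)//= big1 ?addr0 ?mxE ?eqxx ?mulr1// => j ji.
  by rewrite mxE (negbTE ji) mulr0.
(* The coordinate direction is a combination of the edges issued from the first vertex. *)
have -> : delta_mx 0 i = (delta_mx 0 i : 'rV[R]_n.+1) *m invmx M *m M by rewrite (mulmxKV uM).
rewrite mulmx_sum_row; apply: (big_ind (divergence^~ p)).
(* The empty sum: the zero direction is obtained as 0 times an edge. *)
- have [v [w [vK wK vw]]] : exists v w, [/\ v \in K, w \in K & v != w].
    by apply/card_gt1P; rewrite cardK.
  by rewrite -(scale0r (vtx v - vtx w)); exact/divergenceZ/divergence_vertices.
- by move=> *; exact: divergenceD.
move=> j _; apply: divergenceZ; rewrite row_edge_mx.
have [v0 _] := size_mem sk.
have jk : (j.+1 < size (enum K))%N by rewrite sk ltnS.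
rewrite !(nth_map v0)//; last by rewrite sk.
have vK : nth v0 (enum K) j.+1 \in K by rewrite -mem_enum mem_nth.
have wK : nth v0 (enum K) 0 \in K by rewrite -mem_enum mem_nth ?sk.
apply: (divergence_vertices _ vK wK).
by rewrite nth_uniq ?enum_uniq// sk.
Qed.

End divergence_theorem.

(** * Energy estimate on an element *)

Section hermitian_functionals.
Context (R : realType) (n : nat).
Local Notation C := (R[i]).
Local Notation poly := (mpoly n C).

(** Covers the integral over an element and those over its faces at once. *)
Definition hermitian (L : poly -> C) := [/\ forall p q, L (p + q) = L p + L q,
  forall c p, L (c *: p) = c * L p & forall p, L (mconj p) = conjc (L p)].

(* locked, so that comparing two forms never unfolds products of polynomials *)
Definition form := locked (fun (L : poly -> C) (u v : poly) => L (u * mconj v) : C).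

Lemma formE L u v : form L u v = L (u * mconj v).
Proof. by rewrite /form -lock. Qed.

Lemma mconjK (p : poly) : mconj (mconj p) = p.
Proof. by apply/mpolyP => m; rewrite /mconj !mcoeff_map_mpoly; exact: conjcK. Qed.

Lemma conjcN (x : C) : conjc (- x) = - conjc x.
Proof. exact: rmorphN. Qed.

Lemma conjc_sum (I : Type) (r : seq I) (P : pred I) (F : I -> C) :
  conjc (\sum_(i <- r | P i) F i) = \sum_(i <- r | P i) conjc (F i).
Proof. exact: rmorph_sum. Qed.

Variable L : poly -> C.
Hypothesis hL : hermitian L.

Lemma hermitian0 : L 0 = 0.
Proof. by have [_ LZ _] := hL; rewrite -(scale0r (0 : poly)) LZ mul0r. Qed.

Lemma hermitian_sum (I : Type) (r : seq I) (P : pred I) (F : I -> poly) :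
  L (\sum_(i <- r | P i) F i) = \sum_(i <- r | P i) L (F i).
Proof.
have [LD _ _] := hL; elim: r => [|i r IHr]; first by rewrite !big_nil hermitian0.
by rewrite !big_cons; case: ifP => // _; rewrite LD IHr.
Qed.

Lemma formDl u u' v : form L (u + u') v = form L u v + form L u' v.
Proof. by have [LD _ _] := hL; rewrite !formE mulrDl LD. Qed.

Lemma formZl c u v : form L (c *: u) v = c * form L u v.
Proof. by have [_ LZ _] := hL; rewrite !formE -scalerAl LZ. Qed.

Lemma formC u v : form L v u = conjc (form L u v).
Proof. by have [_ _ LC] := hL; rewrite !formE -LC mconjM mconjK mulrC. Qed.

Lemma formDr u v v' : form L u (v + v') = form L u v + form L u v'.
Proof. by rewrite formC formDl conjcD -!formC. Qed.

Lemma formZr c u v : form L u (c *: v) = conjc c * form L u v.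
Proof. by rewrite formC formZl conjcM -formC. Qed.

Lemma formNl u v : form L (- u) v = - form L u v.
Proof. by rewrite -scaleN1r formZl mulN1r. Qed.

Lemma formNr u v : form L u (- v) = - form L u v.
Proof. by rewrite formC formNl conjcN -formC. Qed.

Lemma form_suml (I : Type) (r : seq I) (P : pred I) (F : I -> poly) v :
  form L (\sum_(i <- r | P i) F i) v = \sum_(i <- r | P i) form L (F i) v.
Proof. by rewrite formE mulr_suml hermitian_sum; apply: eq_bigr => i _; rewrite formE. Qed.

Lemma form_sumr (I : Type) (r : seq I) (P : pred I) (F : I -> poly) u :
  form L u (\sum_(i <- r | P i) F i) = \sum_(i <- r | P i) form L u (F i).
Proof.
by rewrite formC form_suml conjc_sum; apply: eq_bigr => i _; rewrite -formC.
Qed.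

Lemma Re_formC u v : Re (form L v u) = Re (form L u v).
Proof. by rewrite formC; case: (form L u v). Qed.

Lemma Im_form_self u : Im (form L u u) = 0.
Proof.
have := congr1 (@complex.Im R) (formC u u); case: (form L u u) => a b /= bb.
by lra.
Qed.

End hermitian_functionals.

Section element_forms.
Context (R : realType) (V : finType) (n : nat) (vtx : V -> 'rV[R]_n.+1) (K : {set V}).
Hypotheses (cardK : #|K| = n.+2) (indK : aff_independent vtx K).
Local Notation C := (R[i]).
Local Notation poly := (mpoly n.+1 C).
Local Notation Delta n := (@unit_simplex R n).

Definition elt_int (p : poly) : C := Cintegral (hull vtx K) (peval p).
Definition face_int F (p : poly) : C := face_integral vtx F (peval p).
Local Notation bK := (form elt_int).
Local Notation bF F := (form (face_int F)).

Lemma hermitian_elt : hermitian elt_int.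
Proof.
have mK := row_measurable_hull cardK indK; have bK := row_bounded_hull vtx cardK.
split=> [p q|c p|p]; rewrite /elt_int.
- by rewrite (funext (pevalD _ _)) CintegralD//; exact: cpolyfun_peval.
- by rewrite (funext (pevalZ _ _)) CintegralZ//; exact: cpolyfun_peval.
- by rewrite (funext (peval_conj _)) Cintegral_conj//; exact: cpolyfun_peval.
Qed.

Lemma eq_face_integral F f g :
  (forall t, Delta n t -> f (face_param vtx F t) = g (face_param vtx F t)) ->
  face_integral vtx F f = face_integral vtx F g.
Proof. by move=> fg; rewrite /face_integral (eq_Cintegral fg). Qed.

Lemma hermitian_face F : hermitian (face_int F).
Proof.
have mD := @row_measurable_unit_simplex R n; have bD := @row_bounded_unit_simplex R n.
have pF p := cpolyfun_affine (face_seq vtx F)`_0 (face_mx vtx F) (cpolyfun_peval p).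
split=> [p q|c p|p]; rewrite /face_int.
- rewrite (funext (pevalD p q)) /face_integral -mulrDr.
  by rewrite -(CintegralD mD bD (pF p) (pF q)).
- rewrite (funext (pevalZ c p)) /face_integral mulrCA.
  by rewrite -(CintegralZ mD bD c (pF p)).
- rewrite (funext (peval_conj p)) /face_integral conjcM conjc_real.
  by rewrite -(Cintegral_conj mD bD (pF p)).
Qed.

Lemma ipK_form u v : ipK vtx K (peval u) (peval v) = bK u v.
Proof. by rewrite formE; apply: eq_Cintegral => x _; rewrite pevalM peval_conj. Qed.

Lemma ipF_form F u v : ipF vtx F (peval u) (peval v) = bF F u v.
Proof.
rewrite formE; apply: eq_face_integral => t _.
by rewrite pevalM peval_conj.
Qed.

Lemma Re_mul_conj (z : C) : Re (z * conjc z) = Re z ^+ 2 + Im z ^+ 2.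
Proof. by case: z => a b /=; rewrite mulrN opprK. Qed.

Lemma Re_form_ge0 p : 0 <= Re (bK p p).
Proof.
rewrite formE /elt_int CintegralE /=; apply: row_integral_ge0 => x _.
rewrite pevalM peval_conj Re_mul_conj.
by rewrite addr_ge0 ?sqr_ge0.
Qed.

Lemma Re_square_eq0 (z : C) : Re z ^+ 2 + Im z ^+ 2 = 0 -> z = 0.
Proof.
move=> /eqP; rewrite paddr_eq0 ?sqr_ge0// !sqrf_eq0 => /andP[/eqP a0 /eqP b0].
exact: complex_ext.
Qed.

Lemma form_face_ge0 F p : 0 <= Re (bF F p p).
Proof.
rewrite formE /face_int /face_integral CintegralE Re_mul /= mul0r subr0.
apply: mulr_ge0; first exact: sqrtr_ge0.
apply: row_integral_ge0 => x _ /=.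
by rewrite pevalM peval_conj Re_mul_conj addr_ge0 ?sqr_ge0.
Qed.

Lemma row_integral_square_eq0 k (S : seq 'rV[R]_n.+1) p :
  row_integral (Delta k) (fun t => Re (peval (p * mconj p) (simplex_map S t))) = 0 ->
  forall t, Delta k t -> peval p (simplex_map S t) = 0.
Proof.
have [pr _] := cpolyfun_affine S`_0 (edge_mx k S) (cpolyfun_peval (p * mconj p)).
move=> /(row_integral_unit_simplex_eq0 pr) p0 t Dt; apply: Re_square_eq0.
rewrite -Re_mul_conj -peval_conj -pevalM; apply: p0 => // x _.
by rewrite pevalM peval_conj Re_mul_conj addr_ge0 ?sqr_ge0.
Qed.

Lemma form_elt_eq0 p : Re (bK p p) = 0 -> forall x, hull vtx K x -> peval p x = 0.
Proof.
have Ks := enumerates_enum K; have sk := enumerates_size Ks; rewrite cardK in sk.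
have uM := edge_mx_unit cardK indK Ks.
rewrite formE /elt_int (Cintegral_hull cardK indK Ks); last exact: cpolyfun_peval.
rewrite CintegralE Re_mul /= mul0r subr0 => /eqP; rewrite mulf_eq0 normr_eq0.
move: uM; rewrite unitmxE unitfE => /negbTE -> /= /eqP /row_integral_square_eq0 p0 x.
by rewrite (hull_simplex_map _ Ks sk) => -[t Dt <-]; exact: p0.
Qed.

Lemma card_face F : F \in faces K -> #|F| = n.+1.
Proof.
move=> /facesP[w wK ->].
by have := cardsD1 w K; rewrite wK cardK => -[].
Qed.

Lemma face_subset F : F \in faces K -> F \subset K.
Proof. by move=> /facesP[w wK ->]; exact: subD1set. Qed.

Lemma hull_face F : F \in faces K -> hull vtx F = face_param vtx F @` Delta n.
Proof.
move=> /card_face cF; have Fs := enumerates_enum F.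
by apply: (hull_simplex_map _ Fs); rewrite -cardE.
Qed.

Lemma form_face_eq0 F p : F \in faces K -> Re (bF F p p) = 0 ->
  forall x, hull vtx F x -> peval p x = 0.
Proof.
move=> FK; rewrite (hull_face FK).
rewrite formE /face_int /face_integral CintegralE Re_mul /= mul0r subr0 => /eqP.
rewrite mulf_eq0 => /orP[/eqP s0|/eqP p0] x [t Dt <-]; last first.
  exact: (row_integral_square_eq0 (S := face_seq vtx F) p0 Dt).
(* A zero surface element would, by [face_area], make the edge matrix of [K] singular. *)
have /facesP[w wK Fw] := FK.
have : (0 < #|K :\ w|)%N by rewrite -Fw (card_face FK).
move=> /card_gt0P[v vF].
have := face_area cardK indK wK vF; rewrite -Fw s0 mul0r => /esym/eqP.
rewrite normr_eq0.
have := edge_mx_unit cardK indK (enumerates_enum K).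
by rewrite unitmxE unitfE => /negbTE ->.
Qed.

Lemma hullS (A B : {set V}) : A \subset B -> hull vtx A `<=` hull vtx B.
Proof.
move=> AB x [w [w0 w1 ->]].
have sumE (M : zmodType) (H : V -> M) :
    \sum_(v in A) H v = \sum_(v in B) (if v \in A then H v else 0).
  rewrite -big_mkcondr; apply: eq_bigl => v.
  by rewrite andbC; case: (boolP (v \in A)) => //= /(fintype.subsetP AB) ->.
exists (fun v => if v \in A then w v else 0); split.
- by move=> v _; case: ifP => // /w0.
- by rewrite -w1 sumE.
- by rewrite sumE; apply: eq_bigr => v _; case: ifP => //; rewrite scale0r.
Qed.

Definition normal_poly F (q : {ffun 'I_n.+1 -> poly}) : poly :=
  \sum_i (unit_normal vtx K F 0 i)%:C *: q i.

Lemma peval_normal_poly F q : normal_trace vtx K F q = peval (normal_poly F q).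
Proof.
apply/funext => x; rewrite /normal_trace peval_sum; apply: eq_bigr => i _.
by rewrite pevalZ.
Qed.

(** The divergence theorem for the products [u * mconj (r i)], summed over [i]; the normal leaves
    the antilinear slot unchanged because it is real. *)
Lemma green u (r : {ffun 'I_n.+1 -> poly}) :
  \sum_i bK (mderiv i u) (r i) + bK u (\sum_i mderiv i (r i)) =
  \sum_(F in faces K) bF F u (normal_poly F r).
Proof.
rewrite (form_sumr hermitian_elt) -big_split /=.
transitivity (\sum_i \sum_(F in faces K) (unit_normal vtx K F 0 i)%:C * bF F u (r i)).
  apply: eq_bigr => i _; rewrite !formE; have [LD _ _] := hermitian_elt; rewrite -LD.
  have <- : mderiv i (u * mconj (r i)) =
      mderiv i u * mconj (r i) + u * mconj (mderiv i (r i)).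
    by rewrite mderivM mderiv_conj.
  rewrite /elt_int (divergence_theorem cardK indK).
  by apply: eq_bigr => F _; rewrite formE.
rewrite exchange_big; apply: eq_bigr => F _ /=.
rewrite (form_sumr (hermitian_face F)); apply: eq_bigr => i _.
by rewrite (formZr (hermitian_face F)) conjc_real.
Qed.

Definition vanishes p := forall x, hull vtx K x -> peval p x = 0.

(** The divergence theorem is applied to [p * mconj (mderiv i p)]. Its face terms vanish with [p],
    and so does the volume term where [p] is not differentiated; the square norm of the derivative
    is what remains. *)
Lemma vanishes_mderiv p i : vanishes p -> vanishes (mderiv i p).
Proof.
move=> p0; apply: form_elt_eq0.
have zero (q : poly) : vanishes (p * q) by move=> x Kx; rewrite pevalM p0 ?mul0r.
have JD := hermitian_elt; have [LD _ _] := JD.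
have : elt_int (mderiv i (p * mconj (mderiv i p))) = 0.
  rewrite /elt_int (divergence_theorem cardK indK) big1// => F FK.
  rewrite -/(face_int F _) -[X in face_int F X]scale1r.
  have -> : face_int F (1 *: (p * mconj (mderiv i p))) = face_int F 0.
    rewrite scale1r; apply: eq_face_integral => t Dt.
    rewrite zero; first by rewrite /peval meval0.
    apply: (hullS (face_subset FK)); rewrite (hull_face FK).
    by exists t.
  by rewrite (hermitian0 (hermitian_face F)) mulr0.
rewrite mderivM LD.
have -> : elt_int (p * mderiv i (mconj (mderiv i p))) = elt_int 0.
  by apply: eq_Cintegral => x Kx; rewrite zero// /peval meval0.
by rewrite (hermitian0 JD) addr0 formE => ->.
Qed.

End element_forms.

Section complex_parts.
Context (R : realType).
Local Notation C := (R[i]).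

Lemma Re_sum (I : Type) (s : seq I) (P : pred I) (F : I -> C) :
  Re (\sum_(i <- s | P i) F i) = \sum_(i <- s | P i) Re (F i).
Proof.
elim: s => [|i s IHs]; first by rewrite !big_nil.
by rewrite !big_cons; case: ifP => // _; rewrite Re_add IHs.
Qed.

Lemma Im_sum (I : Type) (s : seq I) (P : pred I) (F : I -> C) :
  Im (\sum_(i <- s | P i) F i) = \sum_(i <- s | P i) Im (F i).
Proof.
elim: s => [|i s IHs]; first by rewrite !big_nil.
by rewrite !big_cons; case: ifP => // _; rewrite Im_add IHs.
Qed.

Lemma Re_opp (x : C) : Re (- x) = - Re x.
Proof. by case: x. Qed.

Lemma Re_half (x : C) : Re (2^-1 * x) = 2^-1 * Re x.
Proof.
have -> : (2^-1 : C) = (2^-1)%:C by rewrite fmorphV rmorphMn rmorph1.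
by rewrite Re_mul /= mul0r subr0.
Qed.

(** The real parts, isolated from the polynomials. The letters [a], [b], [s], [t] are the terms with
    [kappa], the terms with derivatives, and the outgoing and incoming face terms; the third
    equation is Green's identity, whose [b3] is the conjugate of [b1]. The pairs [uu], ..., [gQ] are
    summed face products. *)
Lemma energy_algebra (a1 b1 s1 t1 a2 b2 s2 t2 b3 s3 : C) (uu uQ QQ gu gQ : R) :
  a1 - b1 + s1 = t1 -> a2 - b2 + s2 = - t2 -> b3 + b2 = s3 ->
  Re a1 = 0 -> Re a2 = 0 -> Re b3 = Re b1 ->
  Re s1 = 2^-1 * (uu + uQ) -> Re s2 = 2^-1 * (uQ + QQ) ->
  Re t1 = 2^-1 * gu -> Re t2 = 2^-1 * gQ -> Re s3 = uQ ->
  uu + QQ - gu + gQ = 0.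
Proof.
move=> /(congr1 (@complex.Re R)) + /(congr1 (@complex.Re R)) + /(congr1 (@complex.Re R)).
rewrite !(Re_add, Re_opp); lra.
Qed.

Lemma sum_energy (I : finType) (P : pred I) (o e gg uu QQ gu gQ : I -> R) :
  (forall i, o i + e i = gg i + 2 * uu i + 2 * QQ i - 2 * gu i + 2 * gQ i) ->
  \sum_(i | P i) uu i + \sum_(i | P i) QQ i - \sum_(i | P i) gu i + \sum_(i | P i) gQ i = 0 ->
  \sum_(i | P i) o i = \sum_(i | P i) gg i - \sum_(i | P i) e i.
Proof.
move=> oe z; have : \sum_(i | P i) (o i + e i) =
    \sum_(i | P i) (gg i + 2 * uu i + 2 * QQ i - 2 * gu i + 2 * gQ i).
  by apply: eq_bigr => i _; exact: oe.
rewrite !big_split /= sumrN -!mulr_sumr; lra.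
Qed.

Lemma half_sum (x y : C) : 2^-1 * (x + y) - 2^-1 * (x - y) = y.
Proof. by field. Qed.

Lemma half_sum' (x y : C) : 2^-1 * (x + y) + 2^-1 * (x - y) = x.
Proof. by field. Qed.

(** Here [x] and [y] come from the traces of [u] and [Q], and the data are [x - y]. Outgoing minus
    incoming terms then leave exactly the [y] of Green's identity; in the second equation the
    opposite sign leaves [x] instead. *)
Lemma strong_algebra (I : finType) (P : pred I) (a b b' : C) (s t x y : I -> C) :
  (forall i, P i -> s i = 2^-1 * (x i + y i)) ->
  (forall i, P i -> t i = 2^-1 * (x i - y i)) ->
  a - b + \sum_(i | P i) s i = \sum_(i | P i) t i ->
  b + b' = \sum_(i | P i) y i -> a + b' = 0.
Proof.
move=> sE tE E yE.
have yst : \sum_(i | P i) y i = \sum_(i | P i) s i - \sum_(i | P i) t i.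
  by rewrite -sumrB; apply: eq_bigr => i Pi; rewrite sE// tE// half_sum.
have -> : b' = \sum_(i | P i) y i - b by rewrite -yE addrAC subrr add0r.
by rewrite yst -E; ring.
Qed.

Lemma strong_algebra' (I : finType) (P : pred I) (a b b' : C) (s t x y : I -> C) :
  (forall i, P i -> s i = 2^-1 * (x i + y i)) ->
  (forall i, P i -> t i = 2^-1 * (x i - y i)) ->
  a - b + \sum_(i | P i) s i = - \sum_(i | P i) t i ->
  b' + b = \sum_(i | P i) x i -> a + b' = 0.
Proof.
move=> sE tE /eqP; rewrite -addr_eq0 => /eqP E yE.
have xst : \sum_(i | P i) x i = \sum_(i | P i) s i + \sum_(i | P i) t i.
  by rewrite -big_split; apply: eq_bigr => i Pi /=; rewrite sE// tE// half_sum'.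
have -> : b' = \sum_(i | P i) x i - b by rewrite -yE addrK.
by rewrite xst -[RHS]E; ring.
Qed.

End complex_parts.

Section form_energy.
Context (R : realType) (n : nat) (L : mpoly n R[i] -> R[i]).
Hypothesis hL : hermitian L.

(** The parallelogram identity for [u] and [Q], together with the cross terms of [g]. *)
Lemma form_energy u Q g :
  Re (form L (u + Q) (u + Q)) + Re (form L (g - (u - Q)) (g - (u - Q))) =
  Re (form L g g) + 2 * Re (form L u u) + 2 * Re (form L Q Q)
  - 2 * Re (form L g u) + 2 * Re (form L g Q).
Proof.
have N x y : form L (- x) y = - form L x y by exact: formNl.
have N' x y : form L x (- y) = - form L x y by exact: formNr.
rewrite !(formDl hL, N) !(formDr hL, N') !(Re_add, Re_opp).
rewrite (Re_formC hL g u) (Re_formC hL g Q) (Re_formC hL u Q).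
lra.
Qed.

End form_energy.

(** * Degrees and the strong equations *)

Section degrees.
Context (R : realType) (n : nat).
Local Notation C := (R[i]).
Local Notation poly := (mpoly n C).

Lemma mmeasure_mderiv i (p : poly) k : (mmeasure mdeg p <= k.+1)%N ->
  (mmeasure mdeg (mderiv i p) <= k)%N.
Proof.
move=> pk; rewrite mmeasureE; apply/bigmax_leqP_seq => m mp _.
have : mnm_add m (mnm1 i) \in msupp p.
  move: mp; rewrite !mcoeff_msupp mcoeff_mderiv; apply: contra => /eqP ->.
  by rewrite mul0rn.
move=> mUp; have : (mdeg (mnm_add m (mnm1 i)) < mmeasure mdeg p)%N.
  exact: mmeasure_mnm_lt.
by rewrite mdegD mdeg1 addn1 => /leq_trans/(_ pk).
Qed.

Lemma deg_leD k (p q : poly) : deg_le k p -> deg_le k q -> deg_le k (p + q).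
Proof.
by move=> pk qk; apply: leq_trans (mmeasureD_le _ _ _) _; rewrite geq_max; exact/andP.
Qed.

Lemma mmeasureZ_leq c (p : poly) k : (mmeasure mdeg p <= k)%N ->
  (mmeasure mdeg (c *: p) <= k)%N.
Proof. by apply: leq_trans; exact: mmeasureZ_le. Qed.

Lemma mmeasure_sum_leq (I : Type) (r : seq I) (P : pred I) (F : I -> poly) k :
  (forall i, (mmeasure mdeg (F i) <= k)%N) ->
  (mmeasure mdeg (\sum_(i <- r | P i) F i) <= k)%N.
Proof.
move=> Fk; apply: (big_ind (fun p => (mmeasure mdeg p <= k)%N)) => //.
  by rewrite mmeasure0.
move=> p q pk qk; apply: leq_trans (mmeasureD_le _ _ _) _.
by rewrite geq_max pk.
Qed.

Lemma deg_le_mderiv i k (p : poly) : deg_le k p -> deg_le k (mderiv i p).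
Proof. by move=> pk; apply: leq_trans (mmeasure_mderiv _ pk) _. Qed.

End degrees.

Section element.
Context (R : realType) (V : finType) (n : nat) (vtx : V -> 'rV[R]_n.+1) (K : {set V}).
Hypotheses (cardK : #|K| = n.+2) (indK : aff_independent vtx K).
Local Notation C := (R[i]).
Local Notation poly := (mpoly n.+1 C).
Local Notation bK := (form (elt_int vtx K)).
Local Notation bF F := (form (face_int vtx F)).
Local Notation vanishes := (vanishes vtx K).
Local Notation normal_poly := (normal_poly vtx K).

Lemma vanishesD p q : vanishes p -> vanishes q -> vanishes (p + q).
Proof. by move=> p0 q0 x Kx; rewrite pevalD p0// q0// addr0. Qed.

Lemma vanishesZ c p : vanishes p -> vanishes (c *: p).
Proof. by move=> p0 x Kx; rewrite pevalZ p0// mulr0. Qed.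

Lemma vanishes_sum (F : 'I_n.+1 -> poly) : (forall i, vanishes (F i)) ->
  vanishes (\sum_i F i).
Proof. by move=> F0 x Kx; rewrite peval_sum big1// => i _; exact: F0. Qed.

(* The strong equations lower the degree of a representative of (u, q) modulo
   the polynomials vanishing on K *)
Lemma strong_solution0 (c : C) (u : poly) (q : 'I_n.+1 -> poly) : c != 0 ->
  vanishes (c *: u + \sum_i mderiv i (q i)) ->
  (forall i, vanishes (c *: q i + mderiv i u)) ->
  vanishes u /\ forall i, vanishes (q i).
Proof.
move=> c0 eu eq.
(* The representatives [u'], [q'] have the values of [u], [q] on [K]; only their degrees are
   controlled. *)
suff low m (u' : poly) (q' : 'I_n.+1 -> poly) : vanishes (u - u') ->
    (forall i, vanishes (q i - q' i)) -> (mmeasure mdeg u' <= m)%N ->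
    (forall i, (mmeasure mdeg (q' i) <= m)%N) -> vanishes u /\ forall i, vanishes (q i).
  have z0 : vanishes 0 by move=> x _; rewrite /peval meval0.
  apply: (low (maxn (mmeasure mdeg u) (\max_i mmeasure mdeg (q i))) u q).
  - by rewrite subrr.
  - by move=> i; rewrite subrr.
  - exact: leq_maxl.
  - by move=> i; apply: leq_trans (leq_maxr _ _); exact: leq_bigmax.
elim: m u' q' => [|m IHm] u' q' uu' qq' u'm q'm.
  (* [mmeasure mdeg] is one more than the degree and takes the value 0 only at the zero polynomial,
     so the descent ends with zero representatives. *)
  have zero (p : poly) : (mmeasure mdeg p <= 0)%N -> p = 0.
    by rewrite leqn0 mmeasure_poly_eq0 => /eqP.
  split=> [|i]; first by move: uu'; rewrite (zero u')// subr0.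
  by have := qq' i; rewrite (zero (q' i))// subr0.
(* The strong equations are solved for [u] and [q], with the current representatives under the
   derivatives. *)
apply: (IHm (- c^-1 *: \sum_i mderiv i (q' i)) (fun i => - c^-1 *: mderiv i u')).
- have -> : u - - c^-1 *: \sum_i mderiv i (q' i) =
      c^-1 *: (c *: u + \sum_i mderiv i (q i)) +
      (- c^-1) *: \sum_i mderiv i (q i - q' i).
    under [X in _ = _ + _ *: X]eq_bigr do rewrite mderivB.
    rewrite sumrB scalerDr scalerA mulVf// scale1r scalerBr !scaleNr opprK.
    by rewrite addrA addrK.
  apply: vanishesD; apply: vanishesZ => //; apply: vanishes_sum => i.
  exact: vanishes_mderiv.
- move=> i; have -> : q i - - c^-1 *: mderiv i u' =
      c^-1 *: (c *: q i + mderiv i u) + (- c^-1) *: mderiv i (u - u').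
    rewrite mderivB scalerDr scalerA mulVf// scale1r scalerBr !scaleNr opprK.
    by rewrite addrA addrK.
  apply: vanishesD; apply: vanishesZ => //; exact: vanishes_mderiv.
- by apply: mmeasureZ_leq; apply: mmeasure_sum_leq => i; exact: mmeasure_mderiv.
- by move=> i; apply: mmeasureZ_leq; exact: mmeasure_mderiv.
Qed.

Lemma face_param_hull F t : F \in faces K -> unit_simplex t ->
  hull vtx F (face_param vtx F t).
Proof. by move=> FK Dt; rewrite (hull_face vtx cardK FK); exists t. Qed.

Lemma ipF_eq_form F f g u v : F \in faces K ->
  (forall x, hull vtx F x -> f x = peval u x) ->
  (forall x, hull vtx F x -> g x = peval v x) -> ipF vtx F f g = bF F u v.
Proof.
move=> FK fu gv; rewrite -ipF_form; apply: eq_face_integral => t Dt.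
by rewrite fu ?gv//; exact: face_param_hull.
Qed.

Lemma eq_form_face F u u' v : F \in faces K ->
  (forall x, hull vtx F x -> peval u x = peval u' x) -> bF F u v = bF F u' v.
Proof. by move=> FK uu'; rewrite -ipF_form; exact: ipF_eq_form. Qed.

Section local_problem.
Variables (p : nat) (kappa : R) (g : {set V} -> 'rV[R]_n.+1 -> C) (G : {set V} -> poly).
Hypothesis gG : forall F, F \in faces K -> forall x, hull vtx F x -> g F x = peval (G F) x.
Variables (u : poly) (q : {ffun 'I_n.+1 -> poly}).
Hypothesis uqP : local_problem vtx p kappa K g (u, q).

Let c : C := - 'i%C * kappa%:C.

Let out F := u + normal_poly F q.
Let defect F := G F - (u - normal_poly F q).

Let eq_u v : deg_le p v ->
  c * bK u v - \sum_i bK (q i) (mderiv i v) + \sum_(F in faces K) 2^-1 * bF F (out F) v =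
  \sum_(F in faces K) 2^-1 * bF F (G F) v.
Proof.
move=> vp; have [_ _ /(_ v vp) E _] := uqP.
have lhs1 : ipK vtx K (peval u) (peval v) = bK u v by exact: ipK_form.
have lhs2 : \sum_i ipK vtx K (peval (q i)) (peval (mderiv i v)) =
    \sum_i bK (q i) (mderiv i v) by apply: eq_bigr => i _; exact: ipK_form.
have lhs3 : \sum_(F in faces K)
      ipF vtx F (Defs.half (outgoing vtx K F (u, q))) (peval v) =
    \sum_(F in faces K) 2^-1 * bF F (out F) v.
  apply: eq_bigr => F FK; rewrite -(formZl (hermitian_face vtx F)).
  apply: ipF_eq_form => // x Fx.
  by rewrite pevalZ /Defs.half /outgoing /= peval_normal_poly pevalD.
have rhs : \sum_(F in faces K) ipF vtx F (Defs.half (g F)) (peval v) =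
    \sum_(F in faces K) 2^-1 * bF F (G F) v.
  apply: eq_bigr => F FK; rewrite -(formZl (hermitian_face vtx F)).
  by apply: ipF_eq_form => // x Fx; rewrite pevalZ /Defs.half gG.
apply: etrans rhs; rewrite -lhs1 -lhs2 -lhs3; exact: E.
Qed.

Let eq_q (r : {ffun 'I_n.+1 -> poly}) : (forall i, deg_le p (r i)) ->
  c * \sum_i bK (q i) (r i) - bK u (\sum_i mderiv i (r i)) +
    \sum_(F in faces K) 2^-1 * bF F (out F) (normal_poly F r) =
  - \sum_(F in faces K) 2^-1 * bF F (G F) (normal_poly F r).
Proof.
move=> rp; have [_ _ _ /(_ r rp) E] := uqP.
have lhs1 : \sum_i ipK vtx K (peval (q i)) (peval (r i)) = \sum_i bK (q i) (r i).
  by apply: eq_bigr => i _; exact: ipK_form.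
have lhs2 : ipK vtx K (peval u) (peval (\sum_i mderiv i (r i))) =
    bK u (\sum_i mderiv i (r i)) by exact: ipK_form.
have lhs3 : \sum_(F in faces K)
      ipF vtx F (Defs.half (outgoing vtx K F (u, q))) (normal_trace vtx K F r) =
    \sum_(F in faces K) 2^-1 * bF F (out F) (normal_poly F r).
  apply: eq_bigr => F FK; rewrite -(formZl (hermitian_face vtx F)).
  apply: ipF_eq_form => // x Fx; last by rewrite peval_normal_poly.
  by rewrite pevalZ /Defs.half /outgoing /= peval_normal_poly pevalD.
have rhs : \sum_(F in faces K) ipF vtx F (Defs.half (g F)) (normal_trace vtx K F r) =
    \sum_(F in faces K) 2^-1 * bF F (G F) (normal_poly F r).
  apply: eq_bigr => F FK; rewrite -(formZl (hermitian_face vtx F)).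
  apply: ipF_eq_form => // x Fx; last by rewrite peval_normal_poly.
  by rewrite pevalZ /Defs.half gG.
apply: etrans (congr1 -%R rhs); rewrite -lhs1 -lhs2 -lhs3; exact: E.
Qed.

Let Re_c (z : C) : Im z = 0 -> Re (c * z) = 0.
Proof. by move=> z0; rewrite Re_mul z0 mulr0 subr0 /c Re_mul /= oppr0 mul0r mulr0 subr0 mul0r. Qed.

Lemma energy_identity :
  \sum_(F in faces K) Re (bF F (out F) (out F)) =
  \sum_(F in faces K) Re (bF F (G F) (G F)) -
  \sum_(F in faces K) Re (bF F (defect F) (defect F)).
Proof.
have [up qp _ _] := uqP.
have hK := hermitian_elt cardK indK; have hF F := hermitian_face vtx F.
have halfO (v : {set V} -> poly) : Re (\sum_(F in faces K) 2^-1 * bF F (out F) (v F)) =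
    2^-1 * (\sum_(F in faces K) Re (bF F u (v F)) +
            \sum_(F in faces K) Re (bF F (normal_poly F q) (v F))).
  rewrite Re_sum -big_split mulr_sumr; apply: eq_bigr => F _.
  by rewrite Re_half (formDl (hF F)) Re_add.
have halfG (v : {set V} -> poly) : Re (\sum_(F in faces K) 2^-1 * bF F (G F) (v F)) =
    2^-1 * \sum_(F in faces K) Re (bF F (G F) (v F)).
  by rewrite Re_sum mulr_sumr; apply: eq_bigr => F _; rewrite Re_half.
apply: (sum_energy (fun F => form_energy (hF F) u (normal_poly F q) (G F))).
apply: (energy_algebra (uQ := \sum_(F in faces K) Re (bF F u (normal_poly F q)))
  (eq_u up) (eq_q qp) (green cardK indK u q)).
- by apply: Re_c; exact: Im_form_self.
- by apply: Re_c; rewrite Im_sum big1// => i _; exact: Im_form_self.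
- by rewrite !Re_sum; apply: eq_bigr => i _; exact: Re_formC.
- have QU : \sum_(F in faces K) Re (bF F (normal_poly F q) u) =
      \sum_(F in faces K) Re (bF F u (normal_poly F q)).
    by apply: eq_bigr => F _; exact: (Re_formC (hF F)).
  by rewrite -QU; exact: (halfO (fun=> u)).
- exact: (halfO (normal_poly^~ q)).
- exact: (halfG (fun=> u)).
- exact: (halfG (normal_poly^~ q)).
- exact: Re_sum.
Qed.

Hypothesis kappa_gt0 : 0 < kappa.

(** The residuals [w] and [z] of the strong equations have degree at most [p], hence are admissible
    tests. Tested with them, and with [u - Q] as data, the local problem says that their square
    norms on [K] are zero. *)
Lemma no_defect : (forall F, F \in faces K -> Re (bF F (defect F) (defect F)) = 0) ->
  vanishes u /\ forall i, vanishes (q i).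
Proof.
move=> D0; have [up qp _ _] := uqP.
have hK := hermitian_elt cardK indK; have hF F := hermitian_face vtx F.
have GE F v : F \in faces K -> bF F (G F) v = bF F u v - bF F (normal_poly F q) v.
  move=> FK; rewrite -(formNl (hF F)) -(formDl (hF F)); apply: eq_form_face => // x Fx.
  apply/eqP; rewrite -subr_eq0; apply/eqP.
  have := form_face_eq0 cardK indK FK (D0 F FK) Fx.
  by rewrite /defect pevalD -scaleN1r pevalZ mulN1r.
pose w := c *: u + \sum_i mderiv i (q i).
pose z : {ffun 'I_n.+1 -> poly} := [ffun i => c *: q i + mderiv i u].
have c0 : c != 0.
  rewrite /c mulf_neq0 ?oppr_eq0//; first by rewrite eq_complex /= oner_eq0 andbF.
  by rewrite eq_complex /= gt_eqF.
have wp : deg_le p w.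
  apply: deg_leD; first exact: mmeasureZ_leq.
  by apply: mmeasure_sum_leq => i; exact: deg_le_mderiv.
have zp i : deg_le p (z i).
  rewrite ffunE; apply: deg_leD; last exact: deg_le_mderiv.
  by apply: mmeasureZ_leq; exact: qp.
have outE F v : bF F (out F) v = bF F u v + bF F (normal_poly F q) v by exact: (formDl (hF F)).
have w0 : bK w w = 0.
  have -> : bK w w = c * bK u w + bK (\sum_i mderiv i (q i)) w.
    by rewrite {1}/w (formDl hK) (formZl hK).
  apply: (strong_algebra (x := fun F => bF F u w) (y := fun F => bF F (normal_poly F q) w)
    _ _ (eq_u wp)).
  - by move=> F _; rewrite outE.
  - by move=> F FK; rewrite GE.
  (* Green's identity has the vector field in the antilinear slot, whereas the first equation has
     [q] in the linear one; hence the conjugation. *)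
  - have := congr1 (@conjc R) (green cardK indK w q).
    rewrite conjcD !conjc_sum -(formC hK) => gw; apply: etrans (etrans gw _).
      by congr (_ + _); apply: eq_bigr => i _; exact: (formC hK).
    by apply: eq_bigr => F _; apply/esym; exact: (formC (hF F)).
have z0 : \sum_i bK (z i) (z i) = 0.
  have -> : \sum_i bK (z i) (z i) =
      c * (\sum_i bK (q i) (z i)) + \sum_i bK (mderiv i u) (z i).
    rewrite mulr_sumr -big_split; apply: eq_bigr => i _.
    by rewrite {1}/z ffunE (formDl hK) (formZl hK).
  apply: (strong_algebra' (x := fun F => bF F u (normal_poly F z))
    (y := fun F => bF F (normal_poly F q) (normal_poly F z)) _ _ (eq_q zp)).
  - by move=> F _; rewrite outE.
  - by move=> F FK; rewrite GE.
  - exact: (green cardK indK u z).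
apply: (strong_solution0 c0).
  by apply: (form_elt_eq0 cardK indK); rewrite -/w w0.
move=> i; have := congr1 (@complex.Re R) z0; rewrite Re_sum => /eqP.
rewrite psumr_eq0; last by move=> j _; exact: Re_form_ge0.
move=> /allP/(_ i (mem_index_enum _))/eqP; rewrite ffunE.
exact: (form_elt_eq0 cardK indK).
Qed.

End local_problem.
End element.

(** * Faces of a conforming mesh *)

Section mesh.
Context (R : realType) (V : finType) (n : nat) (vtx : V -> 'rV[R]_n.+1).
Local Notation C := (R[i]).
Implicit Types (K F : {set V}) (T : {set {set V}}).

Lemma affine_coordinates K x : #|K| = n.+2 -> aff_independent vtx K ->
  exists c : V -> R, \sum_(v in K) c v = 1 /\ \sum_(v in K) c v *: vtx v = x.
Proof.
move=> cardK indK; have Ks := enumerates_enum K.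
have sk := enumerates_size Ks; rewrite cardK in sk.
have [v0 _] := size_mem sk; have us := enum_uniq (mem K).
have size_lt (i : 'I_n.+2) : (i < size (enum K))%N by rewrite sk.
have uM := edge_mx_unit cardK indK Ks.
set S := map vtx (enum K) in uM; set M := edge_mx _ _ in uM.
pose t := (x - S`_0) *m invmx M.
have xE : x = simplex_map S t by rewrite /simplex_map (mulmxKV uM) addrC subrK.
pose c v := if insub (index v (enum K)) is Some i then bary t 0 i else 0.
have cE (i : 'I_n.+2) : c (nth v0 (enum K) i) = bary t 0 i.
  by rewrite /c index_uniq// valK.
exists c; rewrite !(sum_enumerates v0 _ Ks sk) xE simplex_mapE -(sum_bary t).
split; apply: eq_bigr => i _; first exact: cE.
by rewrite cE (nth_map v0).
Qed.

(** If [c v] were nonnegative, a point of [K'] slightly off the barycenter of [F] towards [v'] would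
    lie in [K] as well, hence in [F] by conformity, against the affine independence of the vertices
    of [K']. *)
Lemma opposite_sides K K' F v v' (c : V -> R) :
  #|K| = n.+2 -> aff_independent vtx K' ->
  hull vtx K `&` hull vtx K' = hull vtx (K :&: K')%SET -> K != K' ->
  v \in K -> v' \in K' -> F = K :\ v -> F = K' :\ v' ->
  c v + \sum_(f in F) c f = 1 ->
  vtx v' = c v *: vtx v + \sum_(f in F) c f *: vtx f -> c v < 0.
Proof.
move=> cardK indK' KK' neq vK vK' FK FK' c1 v'E.
rewrite ltNge; apply/negP => cv0.
have cardF : #|F| = n.+1 by have := cardsD1 v K; rewrite vK cardK -FK => -[].
have vF f : f \in F -> f != v by rewrite FK !inE => /andP[].
have v'F f : f \in F -> f != v' by rewrite FK' !inE => /andP[].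
have IF : (K :&: K')%SET = F.
  apply/setP => x; rewrite !inE; apply/andP/idP => [[xK xK']|xF]; last first.
    by split; [move: xF; rewrite FK !inE => /andP[]|move: xF; rewrite FK' !inE => /andP[]].
  apply/negPn/negP => xF; case/negP: neq; apply/eqP.
  have xv : x = v by apply/eqP/negPn/negP => xv; move: xF; rewrite FK !inE xv xK.
  have xv' : x = v' by apply/eqP/negPn/negP => xv'; move: xF; rewrite FK' !inE xv' xK'.
  by rewrite -(finset.setD1K vK) -(finset.setD1K vK') -FK -FK' -xv -xv'.
pose m : R := n.+1%:R; have m0 : 0 < m by rewrite ltr0n.
pose s := \sum_(f in F) `|c f|; have s0 : 0 <= s by exact: sumr_ge0.
(* Chosen so that [b = e * s]: the weights [b + e * c f] of the point in [K] are then nonnegative,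
   whatever the signs of the [c f]. *)
pose e := (1 + m * s)^-1; have ms0 : 0 < 1 + m * s by rewrite ltr_wpDr// mulr_ge0// ltW.
have e0 : 0 < e by rewrite invr_gt0.
have e1 : e <= 1 by rewrite invf_le1// lerDl mulr_ge0// ltW.
pose b := (1 - e) / m.
have b0 : 0 <= b by rewrite divr_ge0 ?subr_ge0// ltW.
have sumb : \sum_(f in F) b = 1 - e.
  by rewrite sumr_const cardF -mulr_natr -/m divfK// gt_eqF.
have sumK (M : zmodType) (H : V -> M) : \sum_(f in K) H f = H v + \sum_(f in F) H f.
  by rewrite (big_setD1 v)//= FK.
have sumK' (M : zmodType) (H : V -> M) : \sum_(f in K') H f = H v' + \sum_(f in F) H f.
  by rewrite (big_setD1 v')//= FK'.
pose y := e *: vtx v' + \sum_(f in F) b *: vtx f.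
have yK' : hull vtx K' y.
  exists (fun f => if f == v' then e else b); split.
  - by move=> f _; case: ifP => // _; exact: ltW.
  - rewrite sumK' eqxx (eq_bigr (fun=> b)) ?sumb ?subrKC// => f /v'F /negbTE -> //.
  - by rewrite sumK' eqxx; congr (_ + _); apply: eq_bigr => f /v'F /negbTE ->.
have yK : hull vtx K y.
  exists (fun f => if f == v then e * c v else b + e * c f); split.
  - move=> f fK; case: ifP => fv; first by rewrite mulr_ge0// ltW.
    have fF : f \in F by rewrite FK !inE fv fK.
    have cs : - c f <= s.
      apply: le_trans (ler_norm _) _; rewrite normrN /s (bigD1 f)//= lerDl.
      exact: sumr_ge0.
    have be : b = e * s.
      have : 1 - e = m * (e * s).
        have : e * (1 + m * s) = 1 by rewrite mulVf// gt_eqF.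
        lra.
      by rewrite /b => ->; rewrite mulrC mulKf// gt_eqF.
    by rewrite be -mulrDr mulr_ge0 ?(ltW e0)//; lra.
  - rewrite sumK eqxx (eq_bigr (fun f => b + e * c f)); last by move=> f /vF /negbTE ->.
    by rewrite big_split /= sumb -mulr_sumr addrCA -mulrDr c1; ring.
  - rewrite sumK eqxx (eq_bigr (fun f => b *: vtx f + e *: (c f *: vtx f))); last first.
      by move=> f /vF /negbTE ->; rewrite scalerDl scalerA.
    rewrite big_split /= -[X in _ + (_ + X)]scaler_sumr addrCA.
    by rewrite -[(e * c v) *: _]scalerA -scalerDr -v'E addrC.
have : hull vtx F y by rewrite -IF -KK'.
move=> [w [_ w1 yE]].
(* The difference of the weights of [y] in [K'] and in [F]: an affine relation with coefficient [e]
   at [v']. *)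
pose d f := if f == v' then e else b - w f.
have d1 : \sum_(f in K') d f = 0.
  rewrite sumK' /d eqxx (eq_bigr (fun f => b - w f)); last by move=> f /v'F /negbTE ->.
  by rewrite sumrB sumb w1; ring.
have dE : \sum_(f in K') d f *: vtx f = 0.
  rewrite sumK' /d eqxx (eq_bigr (fun f => b *: vtx f - w f *: vtx f)); last first.
    by move=> f /v'F /negbTE ->; rewrite scalerBl.
  by rewrite sumrB addrA -/y yE subrr.
have := indK' d d1 dE v' vK'; rewrite /d eqxx => /eqP.
by rewrite gt_eqF.
Qed.

(** If [K2] and [K3] were distinct, [v2] and [v3] would both lie across [F] from [v1], hence on the
    same side of [F], while [opposite_sides] for [K2] and [K3] separates them. *)
Lemma face_shared_twice T Omega K1 K2 K3 F : conforming_mesh vtx T Omega ->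
  K1 \in T -> K2 \in T -> K3 \in T ->
  F \in faces K1 -> F \in faces K2 -> F \in faces K3 ->
  K2 != K1 -> K3 != K1 -> K2 = K3.
Proof.
move=> [Tind _ Tcap] K1T K2T K3T /facesP[v1 v1K F1] /facesP[v2 v2K F2] /facesP[v3 v3K F3] K21 K31.
apply/eqP/negPn/negP => K23.
have [card1 ind1] := Tind _ K1T; have [card2 ind2] := Tind _ K2T; have [card3 ind3] := Tind _ K3T.
have sum1 (M : zmodType) (H : V -> M) : \sum_(f in K1) H f = H v1 + \sum_(f in F) H f.
  by rewrite (big_setD1 v1)//= F1.
have [c [c1 cE]] := affine_coordinates (vtx v2) card1 ind1.
have [c' [c'1 c'E]] := affine_coordinates (vtx v3) card1 ind1.
rewrite !sum1 in c1 cE c'1 c'E.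
have K12 : K1 != K2 by rewrite eq_sym.
have K13 : K1 != K3 by rewrite eq_sym.
have cv : c v1 < 0.
  exact: (opposite_sides card1 ind2 (Tcap _ _ K1T K2T) K12 v1K v2K F1 F2 c1 (esym cE)).
have c'v : c' v1 < 0.
  exact: (opposite_sides card1 ind3 (Tcap _ _ K1T K3T) K13 v1K v3K F1 F3 c'1 (esym c'E)).
(* Eliminating [v1] between the expressions of [v2] and [v3] gives [v3] in terms of [v2] and [F],
   with coefficient [r] at [v2], positive as a quotient of negative numbers. *)
pose r := c' v1 / c v1; have r0 : 0 < r by rewrite nmulr_rgt0// invr_lt0.
have rE : r * c v1 = c' v1 by rewrite divfK// lt_eqF.
have v2F f : f \in F -> f != v2 by rewrite F2 !inE => /andP[].
pose c2 f := if f == v2 then r else c' f - r * c f.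
have c2F f : f \in F -> c2 f = c' f - r * c f by move=> /v2F /negbTE; rewrite /c2 => ->.
have c2v : c2 v2 = r by rewrite /c2 eqxx.
suff : c2 v2 < 0 by rewrite c2v ltNge ltW.
apply: (opposite_sides card2 ind3 (Tcap _ _ K2T K3T) K23 v2K v3K F2 F3).
  rewrite c2v (eq_bigr _ c2F) sumrB -mulr_sumr.
  by move: c1 c'1; move: (\sum_(f in F) c f) (\sum_(f in F) c' f) => a a' e e'; nra.
rewrite c2v (eq_bigr (fun f => c' f *: vtx f - r *: (c f *: vtx f))); last first.
  by move=> f fF; rewrite c2F// scalerBl scalerA.
rewrite sumrB -scaler_sumr -c'E -cE scalerDr scalerA rE.
by rewrite addrA addrAC addrK addrC.
Qed.

End mesh.

(** * Contraction *)

Section norms.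
Context (R : realType) (V : finType) (n : nat) (vtx : V -> 'rV[R]_n.+1).
Local Notation C := (R[i]).
Local Notation point := 'rV[R]_n.+1.
Implicit Types (K F : {set V}) (f g : point -> C).

Lemma pevalB (P Q : mpoly n.+1 C) x : peval (P - Q) x = peval P x - peval Q x.
Proof. exact: mevalB. Qed.

Lemma normF0 F : normF vtx F 0 = 0.
Proof.
rewrite /normF (_ : ipF vtx F 0 0 = 0) ?sqrtr0//.
rewrite -(hermitian0 (hermitian_face vtx F)); apply: eq_face_integral => t _.
by rewrite mul0r /peval meval0.
Qed.

Lemma normFN F f : normF vtx F (- f) = normF vtx F f.
Proof.
congr (Num.sqrt (Re _)); apply: eq_face_integral => t _.
by rewrite -[(- f) _]/(- f _) conjcN mulrNN.
Qed.

Section face.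
Variables (K F : {set V}).
Hypotheses (cardK : #|K| = n.+2) (indK : aff_independent vtx K) (FK : F \in faces K).

Lemma normF_form f P : (forall x, hull vtx F x -> f x = peval P x) ->
  normF vtx F f ^+ 2 = Re (form (face_int vtx F) P P).
Proof.
move=> fP; rewrite /normF (ipF_eq_form cardK FK fP fP).
by rewrite sqr_sqrtr// form_face_ge0.
Qed.

Lemma ext0E (A : set point) f x : A x -> ext0 A f x = f x.
Proof. by move=> Ax; rewrite /ext0 mem_set. Qed.

Lemma normF_eq0 P : normF vtx F (ext0 (hull vtx F) (peval P)) = 0 ->
  ext0 (hull vtx F) (peval P) = 0.
Proof.
move=> N0; have : Re (form (face_int vtx F) P P) = 0.
  by rewrite -(normF_form (fun x Fx => ext0E (peval P) Fx)) N0 expr0n.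
move=> /(form_face_eq0 cardK indK FK) P0; apply/funext => x.
by rewrite /ext0; case: ifPn => // /set_mem /P0.
Qed.

End face.

Section contraction.
Variables (K : {set V}) (p : nat) (kappa : R) (g : {set V} -> point -> C).
Hypotheses (cardK : #|K| = n.+2) (indK : aff_independent vtx K) (kappa_gt0 : 0 < kappa).
Hypothesis gP : forall F, F \in faces K -> PF vtx p F (g F).

Let S F := ext0 (hull vtx F) (outgoing vtx K F (local_solution vtx p kappa K g)).

Lemma local_contraction :
  \sum_(F in faces K) normF vtx F (S F) ^+ 2 <= \sum_(F in faces K) normF vtx F (g F) ^+ 2
  /\ forall F0, F0 \in faces K -> g F0 <> 0 ->
     \sum_(F in faces K) normF vtx F (S F) ^+ 2 < \sum_(F in faces K) normF vtx F (g F) ^+ 2.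
Proof.
(* Only the values of [G F] on the face enter the estimates, so no degree bound is attached to the
   choice. *)
pose G F : mpoly n.+1 C := xget 0 [set P | g F = ext0 (hull vtx F) (peval P)].
have GE F : F \in faces K -> g F = ext0 (hull vtx F) (peval (G F)).
  move=> FK; have [P _ PE] := gP FK.
  by have := @xgetPex _ 0 [set P | g F = ext0 (hull vtx F) (peval P)]; apply; exists P.
have gG F : F \in faces K -> forall x, hull vtx F x -> g F x = peval (G F) x.
  by move=> FK x Fx; rewrite (GE _ FK) ext0E.
have normg F (FK : F \in faces K) := normF_form cardK FK (gG F FK).
rewrite /S /local_solution; case: xgetP => [[u q] _ uqP|_]; last first.
  have S0 : \sum_(F in faces K) normF vtx F
      (ext0 (hull vtx F) (outgoing vtx K F (0, [ffun=> 0]))) ^+ 2 = 0.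
    rewrite big1// => F FK; rewrite (_ : ext0 _ _ = 0) ?normF0 ?expr0n//.
    apply/funext => x; rewrite /ext0; case: ifP => // _.
    rewrite /outgoing /normal_trace /= /peval meval0 add0r big1// => i _.
    by rewrite ffunE meval0 mulr0.
  rewrite S0; split=> [|F0 F0K g0]; first by apply: sumr_ge0 => F _; exact: sqr_ge0.
  rewrite (bigD1 F0)//= ltr_wpDr//; first by apply: sumr_ge0 => F _; exact: sqr_ge0.
  rewrite lt_neqAle sqr_ge0 andbT eq_sym sqrf_eq0; apply/eqP => N0; apply: g0.
  by rewrite GE//; apply: (normF_eq0 cardK indK F0K); rewrite -GE.
have normS F : F \in faces K -> normF vtx F (ext0 (hull vtx F) (outgoing vtx K F (u, q))) ^+ 2 =
    Re (form (face_int vtx F) (u + normal_poly vtx K F q) (u + normal_poly vtx K F q)).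
  move=> FK; apply: (normF_form cardK FK) => x Fx.
  by rewrite ext0E// /outgoing /= peval_normal_poly pevalD.
rewrite (eq_bigr _ normS) (eq_bigr _ normg) (energy_identity cardK indK gG uqP).
set D := \sum_(F in faces K) Re (form _ (G F - _) _).
have D_ge0 : 0 <= D by apply: sumr_ge0 => F _; exact: form_face_ge0.
split=> [|F0 F0K g0]; first by rewrite lerBlDr lerDl.
rewrite ltrBlDr ltrDl lt_neqAle D_ge0 andbT.
rewrite eq_sym psumr_eq0; last by move=> F _; exact: form_face_ge0.
apply/negP => /allP D0.
have {}D0 F (FK : F \in faces K) := eqP (implyP (D0 F (mem_index_enum F)) FK).
have [u0 q0] := no_defect cardK indK gG uqP kappa_gt0 D0.
apply: g0; rewrite GE//; apply/funext => x; rewrite /ext0; case: ifPn => // /set_mem Fx.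
(* A zero defect gives [g = u - Q] on the face, where both traces vanish since the face lies in
   [K]. *)
have Kx := hullS (face_subset F0K) Fx.
have := form_face_eq0 cardK indK F0K (D0 F0 F0K) Fx.
rewrite !pevalB u0//.
have -> : peval (normal_poly vtx K F0 q) x = 0.
  by rewrite peval_sum big1// => i _; rewrite pevalZ q0// mulr0.
by rewrite !subr0.
Qed.

End contraction.

End norms.

(** * The exchange operator *)

Section exchange.
Context (R : realType) (V : finType) (n : nat) (vtx : V -> 'rV[R]_n.+1).
Local Notation C := (R[i]).
Local Notation point := 'rV[R]_n.+1.

(** [partner] is a partial injection of [S] into itself, so each term on the right is used at most
    once. *)
Lemma sum_partner (X : finType) (S : pred X) (partner : X -> option X) (a : X -> R) :
  (forall x, 0 <= a x) ->
  (forall x y, S x -> partner x = Some y -> S y) ->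
  (forall x x' y, S x -> S x' -> partner x = Some y -> partner x' = Some y -> x = x') ->
  \sum_(x | S x) (if partner x is Some y then a y else 0) <= \sum_(x | S x) a x.
Proof.
move=> a0 Sp pinj.
have -> : \sum_(x | S x) (if partner x is Some y then a y else 0) =
    \sum_(x | S x) \sum_(y | S y) (if partner x == Some y then a y else 0).
  apply: eq_bigr => x Sx; case px : (partner x) => [y|]; last by rewrite big1.
  rewrite (bigD1 y (Sp x y Sx px)) /= eqxx big1 ?addr0// => z /andP[_ zy].
  by rewrite ifN// eq_sym; apply: contra zy => /eqP[->].
rewrite exchange_big /=; apply: ler_sum => y Sy.
have [/existsP[x /andP[Sx /eqP px]]|no] := boolP [exists x, S x && (partner x == Some y)].
  rewrite (bigD1 x)//= px eqxx big1 ?addr0// => x' /andP[Sx' x'x].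
  by rewrite ifN//; apply: contra x'x => /eqP px'; apply/eqP/(pinj _ _ y).
rewrite big1// => x Sx; rewrite ifN//; apply: contra no => px.
by apply/existsP; exists x; rewrite Sx.
Qed.

Lemma norm_exchange (T : {set {set V}}) Omega (Gamma : bc -> set point)
    (h : skeleton_family R n.+1 V) : conforming_mesh vtx T Omega ->
  \sum_(K in T) \sum_(F in faces K) normF vtx F (exchange vtx T Omega Gamma h K F) ^+ 2 <=
  \sum_(K in T) \sum_(F in faces K) normF vtx F (h K F) ^+ 2.
Proof.
move=> mesh.
(* The comparison holds face by face: on a boundary face each component keeps its norm or becomes 0,
   on an interior face the components are permuted. *)
have swap (a : {set V} -> {set V} -> R) : \sum_(K in T) \sum_(F in faces K) a K F =
    \sum_F \sum_(K | (K \in T) && (F \in faces K)) a K F.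
  by rewrite (exchange_big_dep predT).
rewrite (swap (fun K F => normF vtx F (exchange vtx T Omega Gamma h K F) ^+ 2)).
rewrite (swap (fun K F => normF vtx F (h K F) ^+ 2)); apply: ler_sum => F _.
have [interior|boundary] := pselect (~ boundary_face vtx Omega F); last first.
  apply: ler_sum => K /andP[KT FK]; rewrite /exchange KT FK /= asboolF//.
  case: ifP => _; first by rewrite normFN.
  by case: ifP => _ //; rewrite normF0 expr0n sqr_ge0.
pose partner K := [pick K' in T | (K' != K) && (F \in faces K')].
have partnerP K K' : partner K = Some K' -> [/\ K' \in T, K' != K & F \in faces K'].
  by rewrite /partner; case: pickP => // L /and3P[? ? ?] [<-].
rewrite (eq_bigr (fun K => if partner K is Some K' then normF vtx F (h K' F) ^+ 2 else 0)).
  apply: (@sum_partner _ (fun K => (K \in T) && (F \in faces K)) partner).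
  - by move=> K; exact: sqr_ge0.
  - by move=> K K' _ /partnerP[-> _ ->].
  move=> K1 K2 K' /andP[K1T FK1] /andP[K2T FK2].
  move=> /partnerP[K'T K'1 FK'] /partnerP[_ K'2 _].
  (* [K1] and [K2] have the same partner [K'], and all three contain [F]. *)
  by apply: (face_shared_twice mesh K'T K1T K2T FK' FK1 FK2); rewrite eq_sym.
move=> K /andP[KT FK]; rewrite /exchange KT FK /= asboolT// -/(partner K).
by case: (partner K) => // ; rewrite normF0 expr0n.
Qed.

End exchange.

Theorem corollary3p6 (R : realType) (d : nat) (d23 : d = 2%N \/ d = 3%N)
  (Omega : set 'rV[R]_d) (Omega_dom : lipschitz_polytopal_domain Omega)
  (Gamma : bc -> set 'rV[R]_d) (Gamma_part : boundary_partition Omega Gamma)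
  (V : finType) (vtx : V -> 'rV[R]_d) (T : {set {set V}})
  (T_mesh : conforming_mesh vtx T Omega)
  (T_fitted : boundary_fitted vtx T Omega Gamma)
  (p : nat) (kappa : R) (kappa_gt0 : 0 < kappa) :
  forall g : skeleton_family R d V, G_h vtx T p g -> g <> 0 ->
    norm_Gh vtx T
      (exchange vtx T Omega Gamma (scattering vtx T p kappa g)) <
    norm_Gh vtx T g.
Proof.
(* Writing [d] as a successor lets the dimension [d.-1] of the faces compute. *)
have [n dE] : exists n, d = n.+1 by case: d23 => ->; eexists.
clear d23 Omega_dom Gamma_part T_fitted; subst d => g gP g0.
have [Tind _ _] := T_mesh.
have gPF K F : K \in T -> F \in faces K -> PF vtx p F (g K F).
  by move=> KT FK; have := gP K F; rewrite KT FK.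
have [K0 [F0 [K0T F0K g00]]] : exists K0 F0, [/\ K0 \in T, F0 \in faces K0 & g K0 F0 <> 0].
  apply: contra_notP g0 => no; apply/funext => K; apply/funext => F.
  have := gP K F; case: ifPn => // /andP[KT FK] _.
  by apply: contra_notP no => gKF; exists K, F.
have SE K : K \in T -> \sum_(F in faces K) normF vtx F (scattering vtx T p kappa g K F) ^+ 2 =
    \sum_(F in faces K) normF vtx F
      (ext0 (hull vtx F) (outgoing vtx K F (local_solution vtx p kappa K (g K)))) ^+ 2.
  by move=> KT; apply: eq_bigr => F FK; rewrite /scattering KT FK.
have lt : \sum_(K in T) \sum_(F in faces K) normF vtx F (scattering vtx T p kappa g K F) ^+ 2 <
    \sum_(K in T) \sum_(F in faces K) normF vtx F (g K F) ^+ 2.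
  (* The strict inequality comes from one element carrying a nonzero component; the others
     contribute weak ones. *)
  rewrite (bigD1 K0)// [ltRHS](bigD1 K0)//=; apply: ltr_leD.
    rewrite SE//; have [card0 ind0] := Tind _ K0T.
    exact: (local_contraction card0 ind0 kappa_gt0 (fun F => gPF K0 F K0T)).2 F0K g00.
  apply: ler_sum => K /andP[KT _]; rewrite SE//; have [cardK indK] := Tind _ KT.
  exact: (local_contraction cardK indK kappa_gt0 (fun F => gPF K F KT)).1.
rewrite /norm_Gh ltr_sqrt; last first.
  apply: le_lt_trans lt; apply: sumr_ge0 => K _; apply: sumr_ge0 => F _; exact: sqr_ge0.
exact: le_lt_trans (norm_exchange _ _ _) lt.
Qed.
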